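(* Let $p\geq 1$ and $n\geq 6$. Then for every tree $T$ of order $n$ with $T\not\cong S_{n}, S_{2,n-2}, S_{3,n-3}$, $$\rho(\mathbf{S}_{p}(T))<\rho(\mathbf{S}_{p}(S_{3,n-3}))<\rho(\mathbf{S}_{p}(S_{2,n-2}))<\rho(\mathbf{S}_{p}(S_{n})),$$ i.e. $S_{n}$, $S_{2,n-2}$, $S_{3,n-3}$ are, respectively, the unique trees of order $n$ with the first three maximum $p$-Sombor spectral radii.
   Context: All graphs are simple and connected; $d_i$ denotes the degree of vertex $v_i$. For $p\neq 0$, the $p$-Sombor matrix $\mathbf{S}_{p}(G)$ of a graph $G$ on $\{v_1,\dots,v_n\}$ has $(i,j)$-entry $(d_i^{p}+d_j^{p})^{1/p}$ if $v_iv_j\in E(G)$ and $0$ otherwise; $\rho(\mathbf{S}_{p}(G))$ denotes its largest eigenvalue. $S_n$ is the star of order $n$. For $2\leq d\leq\lfloor n/2\rfloor$, the double star $S_{d,n-d}$ is the tree of order $n$ consisting of two adjacent vertices $v_1,v_2$, where $v_1$ is adjacent to $d-1$ further pendant vertices and $v_2$ to $n-d-1$ further pendant vertices. *)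

(* Defs.v *)
From HB Require Import structures.
From mathcomp Require Import all_boot all_order all_algebra perm.
From mathcomp Require Import reals exp.
Set Implicit Arguments. Unset Strict Implicit. Unset Printing Implicit Defensive.
Import Order.TTheory GRing.Theory Num.Theory.
Local Open Scope ring_scope.

Definition simple_graph n (e : rel 'I_n) : Prop :=
  (forall x y, e x y = e y x) /\ (forall x, ~~ e x x).

Definition connected_graph n (e : rel 'I_n) : Prop :=
  forall x y, connect e x y.

Definition has_cycle n (e : rel 'I_n) : Prop :=
  exists (x : 'I_n) (s : seq 'I_n),
    [/\ (2 <= size s)%N, uniq (x :: s), path e x s & e (last x s) x].

Definition is_tree n (e : rel 'I_n) : Prop :=
  [/\ simple_graph e, connected_graph e & ~ has_cycle e].

Definition graph_iso n (e1 e2 : rel 'I_n) : Prop :=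
  exists f : {perm 'I_n}, forall x y, e1 x y = e2 (f x) (f y).

Definition deg n (e : rel 'I_n) (x : 'I_n) : nat := #|[pred y | e x y]|.

Definition star_rel n : rel 'I_n :=
  fun x y => (x != y) && ((val x == 0%N) || (val y == 0%N)).

(* double star S_{d,n-d}: v1 = 0, v2 = 1; 0 is adjacent to 1 and to the
   d-1 pendants 2..d; 1 is adjacent to the n-d-1 pendants d+1..n-1. *)
Definition dstar_half (d a b : nat) : bool :=
  [|| (a == 0%N) && (b == 1%N),
      (a == 0%N) && (2 <= b <= d)%N
    | (a == 1%N) && (d < b)%N].

Definition dstar_rel n (d : nat) : rel 'I_n :=
  fun x y => dstar_half d (val x) (val y) || dstar_half d (val y) (val x).

Definition sombor_mx (R : realType) n (p : R) (e : rel 'I_n) : 'M[R]_n :=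
  \matrix_(i, j) (if e i j then
      powR (powR (deg e i)%:R p + powR (deg e j)%:R p) p^-1 else 0).

(* largest eigenvalue (the matrices considered are real symmetric, so the
   set of eigenvalues is finite and nonempty and its sup is its maximum) *)
Definition rho (R : realType) n (A : 'M[R]_n) : R :=
  sup (fun a : R => is_true (eigenvalue A a)).

Arguments star_rel n : clear implicits.
Arguments dstar_rel n d : clear implicits.

(* Main.v *)
(** Since x^p is convex for p >= 1, the weight (a^p + b^p)^(1/p) does not decrease
    when a and b move apart with a + b fixed, and by Minkowski's inequality it is
    convex in a. Hence contracting an edge uv of a tree and hanging v as a leaf on
    the merged vertex increases the Rayleigh quotient of the Perron vector, after
    exchanging the entries at u and v if necessary. Contracting until two internal
    vertices are left leads to a double star, and moving a leaf from the smaller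
    centre of a double star to the larger one again increases the Rayleigh quotient.
    The only tree with more than two internal vertices all of whose contractions
    overshoot S_{3,n-3} is the one with a centre of degree n-3 having two neighbours
    of degree 2; moving one leaf turns it into S_{3,n-3}. *)

Require Import Defs.
From mathcomp Require Import classical_sets interval_inference convex hoelder.
From HB Require Import structures.
From mathcomp Require Import all_boot all_order all_algebra perm.
From mathcomp Require Import reals exp.
From mathcomp Require Import zify ring lra.
Set Implicit Arguments. Unset Strict Implicit. Unset Printing Implicit Defensive.
Import Order.TTheory GRing.Theory Num.Theory.
Local Open Scope ring_scope.

(** Both operations only redirect parents on a fixed vertex set. The edges of the old and of the new
    tree are therefore indexed by the same non-root vertices, and the two quadratic forms are
    compared term by term. Strictness comes from the positivity of the Perron vector together with
    one edge whose weight strictly grows. The obstacle is that contraction must not go too far: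
    [S_{2,n-2}] and [S_n] both lie above the target, so the last double star needs two centres of
    degree at least 3. This dictates the choice of the last contraction. The root is a vertex of
    maximum degree; it is never contracted away and its degree never drops, so only the other centre
    needs care. The bound [6 <= n] enters through paths, where the root has degree 2 and a third
    internal vertex besides it is needed. *)

(* Locked, since otherwise unification unfolds real powers when it compares two
   weights. *)
HB.lock Definition weight {R : realType} (p a b : R) : R :=
  powR (powR a p + powR b p) p^-1.

(** * Convexity and monotonicity of the edge weight *)

Section Weights.
Variables (R : realType) (p : R).
Hypothesis p1 : 1 <= p.

Let p0 : 0 < p. Proof. exact: lt_le_trans p1. Qed.

Lemma powR_convex (t x y : R) : 0 <= t <= 1 -> 0 <= x -> 0 <= y ->
  powR (t * x + (1 - t) * y) p <= t * powR x p + (1 - t) * powR y p.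
Proof.
move=> /andP[t0 t1] x0 y0.
by apply: (convex_powR p1 (Itv01 t0 t1)) => //=;
  rewrite ?classical_sets.inE/= ?in_itv/= ?x0 ?y0.
Qed.

Lemma le_powR a b : 0 <= a -> a <= b -> powR a p <= powR b p.
Proof.
by move=> a0 ab; apply: ge0_ler_powR; rewrite ?nnegrE ?(ltW p0)// (le_trans a0).
Qed.

Lemma lt_powR a b : 0 <= a -> a < b -> powR a p < powR b p.
Proof.
move=> a0 ab; apply: gt0_ltr_powR; rewrite ?nnegrE//.
exact: le_trans (ltW ab).
Qed.

Local Notation weight := (weight p).

Lemma weightE a b : powR (powR a p + powR b p) p^-1 = weight a b.
Proof. by rewrite weight.unlock. Qed.

Lemma weightC a b : weight a b = weight b a.
Proof. by rewrite -!weightE addrC. Qed.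

Lemma weight_ge0 a b : 0 <= weight a b.
Proof. by rewrite -weightE; exact: powR_ge0. Qed.

Lemma weightK a b : powR (weight a b) p = powR a p + powR b p.
Proof.
rewrite -weightE -powRrM mulVf ?gt_eqF// powRr1//.
by rewrite addr_ge0 ?powR_ge0.
Qed.

(** Raising to the power p removes the outer root; the monotonicity and majorization bounds below
    reduce to this form. *)
Lemma le_weightP a b x : 0 <= x ->
  (weight a b <= x) = (powR a p + powR b p <= powR x p).
Proof.
move=> x0; rewrite -weightK; apply/idP/idP => [|].
  exact: le_powR (weight_ge0 _ _).
by apply: contraTT; rewrite -!ltNge; exact: lt_powR.
Qed.

Lemma le_weight a b c d : 0 <= a -> 0 <= b -> a <= c -> b <= d ->
  weight a b <= weight c d.
Proof.
move=> a0 b0 ac bd; rewrite le_weightP ?weight_ge0// weightK.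
by apply: lerD; exact: le_powR.
Qed.

Lemma lt_weight a b c d : 0 <= a -> 0 <= b -> a < c -> b <= d ->
  weight a b < weight c d.
Proof.
move=> a0 b0 ac bd; rewrite ltNge le_weightP ?weight_ge0// weightK -ltNge.
by apply: ltr_leD; [exact: lt_powR|exact: le_powR].
Qed.

Lemma weight_gt0 a b : 0 < a -> 0 <= b -> 0 < weight a b.
Proof.
move=> a0 b0; apply: le_lt_trans (lt_weight (lexx 0) (lexx 0) a0 b0).
exact: weight_ge0.
Qed.

(* Minkowski's inequality for the p-norm of (x, c), obtained from the convexity
   of the p-th power after normalising both vectors. *)
Lemma weight_convex (c t x y : R) : 0 < c -> 0 <= t <= 1 -> 0 <= x -> 0 <= y ->
  weight (t * x + (1 - t) * y) c <= t * weight x c + (1 - t) * weight y c.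
Proof.
move=> c0 t01 x0 y0; have /andP[t0 t1] := t01.
have X0 : 0 < weight x c by rewrite weightC weight_gt0.
have Y0 : 0 < weight y c by rewrite weightC weight_gt0.
have KX := weightK x c; have KY := weightK y c.
move: (weight x c) (weight y c) X0 Y0 KX KY => X Y X0 Y0 KX KY.
have Z0 : 0 < t * X + (1 - t) * Y.
  have [->|tn] := eqVneq t 0; first by rewrite subr0 mul0r add0r mul1r.
  have tp : 0 < t by rewrite lt_neqAle eq_sym tn.
  rewrite ltr_pwDl ?mulr_gt0// mulr_ge0 ?subr_ge0//; exact: ltW.
have [Z EZ] : exists Z, Z = t * X + (1 - t) * Y by eexists.
rewrite -EZ in Z0 *.
rewrite le_weightP ?(ltW Z0)//.
(* [u] is the share of the first vector in the total length [Z]: this choice turns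
   [(t * a + (1 - t) * b) / Z] into a convex combination of [a / X] and [b / Y]. *)
pose u := t * X / Z.
have u01 : 0 <= u <= 1.
  rewrite /u divr_ge0 ?mulr_ge0 ?(ltW X0) ?(ltW Z0)//= ler_pdivrMr// mul1r EZ.
  by rewrite lerDl mulr_ge0 ?subr_ge0 // ltW.
have nx := lt0r_neq0 X0; have ny := lt0r_neq0 Y0; have nz := lt0r_neq0 Z0.
have H (a b : R) : 0 <= a -> 0 <= b ->
  powR (t * a + (1 - t) * b) p <=
  powR Z p * (u * (powR a p / powR X p) + (1 - u) * (powR b p / powR Y p)).
  move=> a0 b0.
  have -> : t * a + (1 - t) * b = Z * (u * (a / X) + (1 - u) * (b / Y)).
    rewrite /u; move: nz; rewrite EZ => nz; field; by rewrite nx ny nz.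
  have /andP[u0 u1] := u01.
  have aX : 0 <= a / X by rewrite divr_ge0// ltW.
  have bY : 0 <= b / Y by rewrite divr_ge0// ltW.
  rewrite powRM ?(ltW Z0)//; last first.
    by apply: addr_ge0; apply: mulr_ge0 => //; rewrite subr_ge0.
  rewrite ler_pM2l ?powR_gt0//.
  apply: le_trans (powR_convex u01 aX bY) _.
  have E (v V : R) : 0 <= v -> 0 < V -> powR (v / V) p = powR v p / powR V p.
    move=> v0 V0; have {2}-> : v = v / V * V by rewrite divfK ?gt_eqF.
    rewrite [in RHS]powRM ?divr_ge0 ?(ltW V0)// mulfK//.
    by rewrite gt_eqF ?powR_gt0.
  by rewrite !E.
have Hc : powR c p <=
  powR Z p * (u * (powR c p / powR X p) + (1 - u) * (powR c p / powR Y p)).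
  by have := H _ _ (ltW c0) (ltW c0); rewrite -mulrDl subrKC mul1r.
apply: le_trans (lerD (H _ _ x0 y0) Hc) _.
rewrite le_eqVlt; apply/orP; left; apply/eqP.
rewrite -mulrDr addrACA -!mulrDr -!mulrDl -KX -KY !divff ?gt_eqF ?powR_gt0//.
by rewrite !mulr1 subrKC mulr1.
Qed.

(** If x is the convex combination of s and t with coefficient l, then y is the one with coefficient
    1 - l, and the two convexity inequalities add up to the claim. *)
Lemma majorize2 (f : R -> R) (s x y t : R) :
  (forall l u v, 0 <= l <= 1 -> 0 <= u -> 0 <= v ->
     f (l * u + (1 - l) * v) <= l * f u + (1 - l) * f v) ->
  0 <= s -> s <= x -> x <= t -> s + t = x + y -> f x + f y <= f s + f t.
Proof.
move=> cf s0 sx xt e.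
have [st|st] := ltP s t; last first.
  have sxE : x = s by lra.
  have -> : t = s by lra.
  have -> : y = s by lra.
  by rewrite sxE.
have t0 : 0 <= t by lra.
have ts : t - s != 0 by rewrite subr_eq0 gt_eqF.
pose l := (t - x) / (t - s).
have l01 : 0 <= l <= 1.
  by rewrite /l divr_ge0 ?subr_ge0 ?(ltW st)//= ler_pdivrMr ?subr_gt0//; lra.
have l01' : 0 <= 1 - l <= 1 by move: l01 => /andP[? ?]; apply/andP; split; lra.
have -> : x = l * s + (1 - l) * t by rewrite /l; field.
have -> : y = (1 - l) * s + (1 - (1 - l)) * t.
  have -> : y = s + t - x by lra.
  by rewrite /l; field.
have := cf _ _ _ l01 s0 t0; have := cf _ _ _ l01' s0 t0.
move=> A B; apply: le_trans (lerD B A) _.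
by rewrite le_eqVlt; apply/orP; left; apply/eqP; ring.
Qed.

Lemma weight_majorize s x y t : 0 <= s -> s <= x -> x <= t -> s + t = x + y ->
  weight x y <= weight s t.
Proof.
move=> s0 sx xt e; rewrite le_weightP ?weight_ge0// weightK.
by apply: (@majorize2 (fun z => powR z p)) => // l u v; exact: powR_convex.
Qed.

Lemma weight_incr c s x y t : 0 < c -> 0 <= s -> s <= x -> x <= t ->
  s + t = x + y -> weight x c + weight y c <= weight s c + weight t c.
Proof.
move=> c0 s0 sx xt e.
by apply: (@majorize2 (fun z => weight z c)) => // l u v; exact: weight_convex.
Qed.

End Weights.

(** * Rayleigh quotients of symmetric matrices *)

Section Rayleigh.
Variables (R : realType) (n : nat).
Implicit Types (A M : 'M[R]_n) (x y : 'rV[R]_n).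

Definition bform A x y : R := (x *m A *m y^T) 0 0.
Definition sqnorm x : R := \sum_i x 0 i ^+ 2.

Lemma bformE A x y : bform A x y = \sum_i \sum_j A i j * (x 0 i * y 0 j).
Proof.
rewrite /bform mxE exchange_big; apply: eq_bigr => j _ /=.
by rewrite !mxE big_distrl; apply: eq_bigr => i _ /=; ring.
Qed.

Lemma bform1 x : bform 1%:M x x = sqnorm x.
Proof.
by rewrite /bform mulmx1 mxE; apply: eq_bigr => j _ /=; rewrite mxE expr2.
Qed.

Lemma bformDl A x y z : bform A (x + y) z = bform A x z + bform A y z.
Proof. by rewrite /bform !mulmxDl mxE. Qed.

Lemma bformDr A x y z : bform A z (x + y) = bform A z x + bform A z y.
Proof. by rewrite /bform linearD mulmxDr mxE. Qed.

Lemma bformZl A a x y : bform A (a *: x) y = a * bform A x y.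
Proof. by rewrite /bform -!scalemxAl mxE. Qed.

Lemma bformZr A a x y : bform A x (a *: y) = a * bform A x y.
Proof. by rewrite /bform linearZ -scalemxAr mxE. Qed.

Lemma bformC A x y : A^T = A -> bform A x y = bform A y x.
Proof.
move=> sA; rewrite !bformE exchange_big; apply: eq_bigr => i _; apply: eq_bigr => j _.
by rewrite -[in LHS]sA mxE [x 0 j * _]mulrC.
Qed.

Lemma sqnorm_ge0 x : 0 <= sqnorm x.
Proof. by apply: sumr_ge0 => i _; exact: sqr_ge0. Qed.

Lemma sqnorm_gt0 x : x != 0 -> 0 < sqnorm x.
Proof.
move=> x0; rewrite lt_neqAle sqnorm_ge0 andbT eq_sym; apply: contra x0.
rewrite psumr_eq0 => [/allP h|i _]; last exact: sqr_ge0.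
apply/eqP/rowP => i; rewrite mxE; apply/eqP.
by have := h i; rewrite mem_index_enum sqrf_eq0 => /(_ isT).
Qed.

Lemma bform_bounded A : exists2 K, 0 < K & forall x, bform A x x <= K * sqnorm x.
Proof.
exists (1 + \sum_i \sum_j `|A i j|) => [|x].
  by rewrite ltr_pwDl// sumr_ge0// => i _; exact: sumr_ge0.
rewrite mulrDl mul1r ler_wpDl ?sqnorm_ge0// bformE mulr_suml.
apply: ler_sum => i _; rewrite mulr_suml; apply: ler_sum => j _.
have sq k : x 0 k ^+ 2 <= sqnorm x.
  by rewrite /sqnorm (bigD1 k)//= lerDl sumr_ge0// => l _; exact: sqr_ge0.
apply: le_trans (ler_norm _) _; rewrite normrM; apply: ler_wpM2l => //.
have Hi := sq i; have Hj := sq j.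
(* The two squares bound the product of the entries from above and from below by half the sum of
   their squares. *)
have D1 := sqr_ge0 (x 0 i - x 0 j); have D2 := sqr_ge0 (x 0 i + x 0 j).
by rewrite ler_norml; apply/andP; split; nra.
Qed.

(** * Positive semidefinite forms *)

Section PositiveSemidefinite.
Variable M : 'M[R]_n.
Hypotheses (sM : M^T = M) (M0 : forall x, 0 <= bform M x x).

Lemma psd_cauchy_schwarz x y : bform M x y ^+ 2 <= bform M x x * bform M y y.
Proof.
have H t : 0 <= bform M x x + 2 * t * bform M x y + t ^+ 2 * bform M y y.
  apply: le_trans (M0 (x + t *: y)) _; rewrite le_eqVlt; apply/orP; left; apply/eqP.
  by rewrite bformDl !bformDr !bformZl !bformZr (bformC y x sM); ring.
have := M0 x; have := M0 y; move: H.
move: (bform M x x) (bform M x y) (bform M y y) => a b c H c0 a0.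
have [cE|cn] := eqVneq c 0.
  have [->|bn] := eqVneq b 0; first by rewrite expr0n/= mulr_ge0.
  (* Without its quadratic term the expression is affine in t; at this t it equals -1. *)
  have := H (- (a + 1) / (2 * b)); rewrite cE mulr0 addr0.
  have -> : 2 * (- (a + 1) / (2 * b)) * b = - (a + 1) by field.
  by move=> ?; exfalso; lra.
have cp : 0 < c by rewrite lt_neqAle eq_sym cn.
(* The minimum of the quadratic in t. *)
have := H (- b / c).
have -> : a + 2 * (- b / c) * b + (- b / c) ^+ 2 * c = (a * c - b ^+ 2) / c by field.
by rewrite pmulr_lge0 ?invr_gt0// subr_ge0.
Qed.

(** Cauchy-Schwarz against the vector [x *m M] bounds the square of its squared norm by 0. *)
Lemma psd_kernel x : bform M x x = 0 -> x *m M = 0.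
Proof.
move=> x0; apply/eqP; apply: contraT => /sqnorm_gt0; rewrite -bform1.
have := psd_cauchy_schwarz x (x *m M).
by rewrite x0 mul0r /bform mulmx1; nra.
Qed.

(* By Cauchy-Schwarz applied to x and x M^-1. *)
Lemma psd_coercive : M \in unitmx ->
  exists2 K, 0 < K & forall x, sqnorm x <= K * bform M x x.
Proof.
move=> uM; have [K K0 HK] := bform_bounded (invmx M); exists K => // x.
have := psd_cauchy_schwarz x (x *m invmx M).
have sN : (invmx M)^T = invmx M by rewrite trmx_inv sM.
have -> : bform M x (x *m invmx M) = sqnorm x.
  by rewrite /bform trmx_mul sN !mulmxA mulmxK// -bform1 /bform mulmx1.
have -> : bform M (x *m invmx M) (x *m invmx M) = bform (invmx M) x x.
  by rewrite /bform trmx_mul sN !mulmxA mulmxKV// .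
have := HK x; have := M0 x; have := sqnorm_ge0 x.
move: (sqnorm x) (bform M x x) (bform (invmx M) x x) => s b c s0 b0 cs h.
have [->|sn] := eqVneq s 0; first by rewrite mulr_ge0 // ltW.
have sp : 0 < s by rewrite lt_neqAle eq_sym sn.
have : s * s <= b * K * s by rewrite -mulrA -expr2; apply: le_trans h _; exact: (ler_wpM2l b0 cs).
by rewrite ler_pM2r// mulrC.
Qed.

End PositiveSemidefinite.

(** * The largest eigenvalue as a maximal Rayleigh quotient *)

Variable A : 'M[R]_n.
Hypotheses (n0 : (0 < n)%N) (sA : A^T = A).

Let rayleigh : set R := fun a => exists2 x, x != 0 & a = bform A x x / sqnorm x.

Lemma sub_scalar_bform a x : bform (a%:M - A) x x = a * sqnorm x - bform A x x.
Proof.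
rewrite /bform mulmxBr mulmxBl mul_mx_scalar -scalemxAl -bform1 /bform mulmx1.
by rewrite !mxE.
Qed.

Let has_sup_rayleigh : has_sup rayleigh.
Proof.
have [K K0 HK] := bform_bounded A; split.
  exists (bform A (const_mx 1) (const_mx 1) / sqnorm (const_mx 1)), (const_mx 1) => //.
  by apply/eqP => /rowP/(_ (Ordinal n0)); rewrite !mxE => /eqP; rewrite oner_eq0.
by exists K => _ [x x0 ->]; rewrite ler_pdivrMr ?sqnorm_gt0.
Qed.

Let le_sup x : bform A x x <= sup rayleigh * sqnorm x.
Proof.
have [->|x0] := eqVneq x 0.
  by rewrite /bform /sqnorm !mul0mx mxE big1 ?mulr0// => i _; rewrite mxE expr0n.
rewrite -ler_pdivrMr ?sqnorm_gt0//; apply: sup_upper_bound => //.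
by exists x.
Qed.

Let sup_form_psd x : 0 <= bform ((sup rayleigh)%:M - A) x x.
Proof. by rewrite sub_scalar_bform subr_ge0. Qed.

Let sup_form_sym : ((sup rayleigh)%:M - A)^T = (sup rayleigh)%:M - A.
Proof. by rewrite linearB /= tr_scalar_mx sA. Qed.

(** If [M] were invertible, coercivity would keep every Rayleigh quotient at least 1/K below the
    supremum. So [M] is singular, and a kernel vector is the eigenvector; the supremum is attained
    without a compactness argument. *)
Let sup_eigenvector : exists2 x : 'rV[R]_n, x != 0 & x *m A = sup rayleigh *: x.
Proof.
set M := (sup rayleigh)%:M - A.
have [uM|] := boolP (M \in unitmx).
  have [K K0 HK] := psd_coercive sup_form_sym sup_form_psd uM.
  have Ki : 0 < K^-1 by rewrite invr_gt0.
  have [_ [x x0 ->]] := sup_adherent Ki has_sup_rayleigh.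
  have sx := sqnorm_gt0 x0.
  rewrite ltr_pdivlMr// mulrBl ltrBlDr -ltrBlDl -sub_scalar_bform -/M.
  by rewrite -(ltr_pM2l K0) mulVKf ?gt_eqF// ltNge HK.
rewrite unitmxE unitfE negbK => /det0P [x x0 xM]; exists x => //.
by move: xM => /eqP; rewrite /M mulmxBr mul_mx_scalar subr_eq0 => /eqP.
Qed.

Let rho_sup : rho A = sup rayleigh.
Proof.
have [x x0 xA] := sup_eigenvector.
have ub : ubound (fun a => is_true (eigenvalue A a)) (sup rayleigh).
  move=> a /eigenvalueP [v vA v0]; rewrite -(ler_pM2r (sqnorm_gt0 v0)).
  apply: le_trans (le_sup v).
  by rewrite /bform vA -scalemxAl mxE -bform1 /bform mulmx1.
have ev : eigenvalue A (sup rayleigh) by apply/eigenvalueP; exists x.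
apply/eqP; rewrite eq_le; apply/andP; split.
  by apply: ge_sup => //; exists (sup rayleigh).
by apply: ub_le_sup => //; exists (sup rayleigh).
Qed.

Lemma le_rho (f : 'I_n -> R) :
  \sum_i \sum_j A i j * (f i * f j) <= rho A * \sum_i f i ^+ 2.
Proof.
have := le_sup (\row_i f i); rewrite -rho_sup bformE /sqnorm.
under eq_bigr => i _ do under eq_bigr => j _ do rewrite !mxE.
by under [X in _ * X]eq_bigr => i _ do rewrite !mxE.
Qed.

(* If x is an eigenvector for the largest eigenvalue rho then |x| is another
   one, because the Rayleigh quotient of |x| is at least that of x. *)
Lemma rho_ge0_eigenvector : (forall i j, 0 <= A i j) ->
  exists f : 'I_n -> R, [/\ forall i, 0 <= f i, exists i, f i != 0 &
    forall i, \sum_j A i j * f j = rho A * f i].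
Proof.
move=> A0; have [x x0 xA] := sup_eigenvector.
pose y : 'rV[R]_n := \row_i `|x 0 i|.
have sy : sqnorm y = sqnorm x.
  by apply: eq_bigr => i _; rewrite mxE real_normK ?num_real.
have yM : y *m ((sup rayleigh)%:M - A) = 0.
  apply: (psd_kernel sup_form_sym sup_form_psd).
  apply/eqP; rewrite eq_le sup_form_psd andbT sub_scalar_bform sy subr_le0.
  have -> : sup rayleigh * sqnorm x = bform A x x.
    by rewrite /bform xA -scalemxAl mxE -bform1 /bform mulmx1.
  rewrite !bformE; apply: ler_sum => i _; apply: ler_sum => j _.
  by rewrite !mxE -normrM ler_wpM2l// ler_norm.
exists (fun i => `|x 0 i|); split => [i||i]; first exact: normr_ge0.
  have [i xi] := rV0Pn _ x0; exists i; by rewrite normr_eq0.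
move: yM => /eqP; rewrite mulmxBr mul_mx_scalar subr_eq0 => /eqP /rowP /(_ i).
rewrite rho_sup !mxE => ->; apply: eq_bigr => j _.
by rewrite mxE mulrC -[in LHS]sA mxE.
Qed.

End Rayleigh.

(** * Rooted trees and double stars *)

Section RootedTrees.
Variable n : nat.
Implicit Types (r x y z u v w : 'I_n) (par : 'I_n -> 'I_n) (e : rel 'I_n).

(* A tree is encoded by a root r and a parent map; the value of the parent map
   at r is junk. *)
Definition rooted par r := exists h : 'I_n -> nat,
  forall x, x != r -> (h (par x) < h x)%N.
Definition children par r v : {set 'I_n} := [set c | (c != r) && (par c == v)].
Definition parent_rel par r : rel 'I_n :=
  fun x y => ((x != r) && (par x == y)) || ((y != r) && (par y == x)).
Definition pdeg par r x : nat := (#|children par r x| + (x != r))%N.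
(** The root is excluded because it is never contracted: each contraction removes exactly one
    element of this set, and a double star is the case of a single element. *)
Definition internal par r : {set 'I_n} :=
  [set v | (v != r) && (children par r v != set0)].
Definition double_star par r v :=
  [/\ v != r, par v = r & forall z, z != r -> par z = r \/ par z = v].

Lemma rooted_irr par r x : rooted par r -> x != r -> par x != x.
Proof. by case=> h hP xr; apply: contraTneq (hP _ xr) => ->; rewrite ltnn. Qed.

Lemma rooted_asym par r x y : rooted par r -> x != r -> par x = y ->
  y != r -> par y != x.
Proof.
case=> h hP xr <- yr; apply/eqP => E.
by have := hP _ xr; have := hP _ yr; rewrite E; lia.
Qed.

Lemma mem_children par r x : x != r -> x \in children par r (par x).
Proof. by move=> xr; rewrite inE xr eqxx. Qed.

Lemma parent_relC par r x y : parent_rel par r x y = parent_rel par r y x.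
Proof. by rewrite /parent_rel orbC. Qed.

Lemma big_parent_rel (T : pzSemiRingType) par r x (F : 'I_n -> T) : rooted par r ->
  \sum_(y | parent_rel par r x y) F y =
  (if x != r then F (par x) else 0) + \sum_(y in children par r x) F y.
Proof.
move=> rt; rewrite (bigID (fun y => (x != r) && (par x == y))) /=; congr (_ + _).
  case: ifPn => xr.
    rewrite (big_pred1 (par x)) // => y /=.
    by rewrite /parent_rel xr /= eq_sym; case: eqP => //; rewrite andbF.
  by rewrite big_pred0 // => y; rewrite /= andbF.
apply: eq_bigl => y; rewrite /parent_rel inE.
have [xr|xr] := eqVneq x r; first by rewrite /= andbT.
have [E|E] := eqVneq (par x) y; last by rewrite /= andbT.
apply/esym/negP => /andP[yr].
exact/negP/(rooted_asym rt xr E yr).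
Qed.

Lemma deg_parent_rel par r x : rooted par r -> deg (parent_rel par r) x = pdeg par r x.
Proof.
move=> rt; rewrite /deg -sum1_card.
have -> : \sum_(y in [pred y | parent_rel par r x y]) 1%N =
          \sum_(y | parent_rel par r x y) 1%N by apply: eq_bigl.
rewrite (big_parent_rel x (fun=> 1%N) rt) sum1_card /pdeg addrC.
by congr (_ + _)%N; case: ifP.
Qed.

(** Each non-root vertex is counted once, at its parent. This plays the part of the handshake
    lemma. *)
Lemma sum_children par r : (\sum_x #|children par r x| = n.-1)%N.
Proof.
under eq_bigr => x _ do rewrite -sum1_card.
rewrite (exchange_big_dep (fun c => c != r)) /= => [|x c _]; last first.
  by rewrite inE => /andP[].
have E c : c != r -> \sum_(x | c \in children par r x) 1%N = 1%N.
  move=> cr; rewrite (big_pred1 (par c)) // => x.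
  by rewrite /= inE cr eq_sym.
rewrite (eq_bigr _ E) sum1_card.
by rewrite (eq_card (B := predC1 r))// cardC1 card_ord.
Qed.

Lemma children_leaf par r x : x != r -> x \notin internal par r ->
  children par r x = set0.
Proof. by move=> xr; rewrite inE xr /= negbK => /eqP. Qed.

Lemma par_internal par r x : x != r -> par x != r -> par x \in internal par r.
Proof.
move=> xr pr; rewrite inE pr /=; apply/set0Pn; exists x; exact: mem_children.
Qed.

Lemma double_star_rooted par r v : double_star par r v -> rooted par r.
Proof.
case=> vr pv H; exists (fun x => if x == r then 0%N else if x == v then 1%N else 2%N).
move=> x xr; rewrite (negbTE xr).
have [->|xv] := eqVneq x v; first by rewrite pv eqxx.
by case: (H _ xr) => ->; [rewrite eqxx|rewrite (negbTE vr) eqxx].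
Qed.

Lemma double_star_children par r v x : double_star par r v -> x != r -> x != v ->
  children par r x = set0.
Proof.
case=> vr pv H xr xv; apply/setP => c; rewrite !inE.
apply/negP => /andP[cr /eqP E].
by case: (H _ cr) => E'; [move: xr|move: xv]; rewrite -E E' eqxx.
Qed.

Lemma double_star_pdegD par r v : double_star par r v ->
  (pdeg par r r + pdeg par r v = n)%N.
Proof.
move=> ds; have [vr _ _] := ds.
have := sum_children par r; rewrite (bigD1 r) //= (bigD1 v) //=.
rewrite big1 ?addn0 => [|x /andP[xr xv]]; last first.
  by rewrite (double_star_children ds) ?cards0.
rewrite /pdeg eqxx vr /= => E; have := ltn_ord r; lia.
Qed.

End RootedTrees.

(** * Isomorphisms of double stars *)

Section Isomorphism.
Variable n : nat.
Implicit Types (r x y z u v w : 'I_n) (par : 'I_n -> 'I_n) (e : rel 'I_n).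

Lemma graph_iso_sym e1 e2 : graph_iso e1 e2 -> graph_iso e2 e1.
Proof.
by case=> f H; exists (f^-1)%g => x y; rewrite H !permKV.
Qed.

Lemma graph_iso_trans e1 e2 e3 : graph_iso e1 e2 -> graph_iso e2 e3 -> graph_iso e1 e3.
Proof. by case=> f F [g G]; exists (f * g)%g => x y; rewrite !permM F G. Qed.

Lemma eq_graph_iso e1 e2 : e1 =2 e2 -> graph_iso e1 e2.
Proof. by move=> E; exists 1%g => x y; rewrite !perm1 E. Qed.

(** When adjacency depends only on a label and each label occurs equally often in both graphs, the
    two lists of labels are permutations of each other, and such a permutation is an isomorphism. *)
Lemma graph_iso_blocks (K : eqType) (adj : rel K) (c1 c2 : 'I_n -> K) e1 e2 :
  (forall x y, e1 x y = adj (c1 x) (c1 y)) ->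
  (forall x y, e2 x y = adj (c2 x) (c2 y)) ->
  (forall k, #|[pred x | c1 x == k]| = #|[pred x | c2 x == k]|) ->
  graph_iso e1 e2.
Proof.
move=> E1 E2 C.
have pe : perm_eq [tuple c1 i | i < n] [tuple c2 i | i < n].
  have H (c : 'I_n -> K) k :
      count_mem k [tuple c i | i < n] = #|[pred x | c x == k]|.
    by rewrite /= count_map -sum1_count big_enum_cond -sum1_card; apply: eq_bigl.
  by apply/allP => k _; rewrite /= !H C.
have [f Ef] := tuple_permP pe.
exists f => x y; rewrite E1 E2.
have Hf i : c1 i = c2 (f i).
  have Et : [tuple c1 i | i < n] = [tuple tnth [tuple c2 i | i < n] (f i) | i < n].
    exact: val_inj.
  by have := congr1 (fun t => tnth t i) Et; rewrite !tnth_mktuple.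
by rewrite !Hf.
Qed.

(** The first bit marks the two centres, the second the side of [v]. The guard [x != r] discards the
    junk parent of the root. *)
Let block par r v x : bool * bool :=
  ((x == r) || (x == v), (x == v) || ((x != r) && (par x == v))).

Let block_adj : rel (bool * bool) := fun a b =>
  [&& a.1, b.1 & a.2 != b.2] || ((a.1 != b.1) && (a.2 == b.2)).

Let block_rel par r v x y : double_star par r v ->
  parent_rel par r x y = block_adj (block par r v x) (block par r v y).
Proof.
case=> vr pv H; have rv : r != v by rewrite eq_sym.
have P z : z != r -> z != v -> par z = r \/ par z = v by move=> zr _; exact: H.
rewrite /parent_rel /block_adj /block.
have [->|xr] := eqVneq x r; have [->|yr] := eqVneq y r;
  rewrite /= ?eqxx ?(negbTE rv) ?(negbTE vr) /= ?pv ?eqxx //.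
- have [->|yv] := eqVneq y v; first by rewrite pv eqxx.
  by case: (P _ yr yv) => ->; rewrite ?eqxx ?(negbTE rv) ?(negbTE vr).
- have [->|xv] := eqVneq x v; first by rewrite pv eqxx.
  by case: (P _ xr xv) => ->; rewrite ?eqxx ?(negbTE rv) ?(negbTE vr).
have [->|xv] := eqVneq x v; have [->|yv] := eqVneq y v;
  rewrite ?pv ?(negbTE rv) ?(negbTE vr) //= ?orbF.
- by rewrite eq_sym (negbTE yr) /=; case: eqP.
- by rewrite [r == x]eq_sym (negbTE xr) /= orbF; case: eqP.
by case: (P _ xr xv) => ->; case: (P _ yr yv) => ->;
  rewrite ?eqxx ?[r == _]eq_sym ?[v == _]eq_sym ?(negbTE xr) ?(negbTE yr) ?(negbTE xv) ?(negbTE yv) ?(negbTE rv) ?(negbTE vr).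
Qed.

Let card_block par r v k : double_star par r v ->
  #|[pred x | block par r v x == k]| =
  (if k.1 then 1 else if k.2 then #|children par r v| else n.-2 - #|children par r v|)%N.
Proof.
move=> ds; have [vr pv H] := ds; have rv : r != v by rewrite eq_sym.
have Ev : children par r v =i [pred x | block par r v x == (false, true)].
  move=> x; rewrite !inE /block xpair_eqE.
  have [->|xr] := eqVneq x r => //=.
  have [->|xv] := eqVneq x v => /=; first by rewrite pv (negbTE rv).
  by case: (par x == v).
case: k => [[] []] /=.
- rewrite -(card1 v); apply: eq_card => x; rewrite !inE /block xpair_eqE.
  have [->|xr] := eqVneq x r; first by rewrite /= (negbTE rv).
  by have [->|xv] := eqVneq x v.
- rewrite -(card1 r); apply: eq_card => x; rewrite !inE /block xpair_eqE.
  have [->|xr] := eqVneq x r; first by rewrite /= (negbTE rv).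
  by have [->|xv] := eqVneq x v.
- by rewrite -(eq_card Ev).
have := cardC (children par r v); rewrite card_ord.
have -> : #|[predC children par r v]| =
   (#|[pred x | block par r v x == (false, false)]| + 2)%N.
  rewrite (cardD1 r) (cardD1 v) !inE eqxx vr pv /= (negbTE rv) /= addnA addnC addnA.
  rewrite -addnA; congr (_ + _)%N; apply: eq_card => x; rewrite !inE /block xpair_eqE.
  have [->|xr] := eqVneq x r => //=; rewrite ?andbF//.
  by have [->|xv] := eqVneq x v => //=; rewrite ?andbT; case: (par x == v).
by move: #|_| #|_| => a b; lia.
Qed.

Lemma double_star_iso par1 par2 r1 r2 v1 v2 :
  double_star par1 r1 v1 -> double_star par2 r2 v2 ->
  pdeg par1 r1 v1 = pdeg par2 r2 v2 ->
  graph_iso (parent_rel par1 r1) (parent_rel par2 r2).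
Proof.
move=> ds1 ds2; have [v1r _ _] := ds1; have [v2r _ _] := ds2.
rewrite /pdeg v1r v2r => /addIn E.
apply: (@graph_iso_blocks _ block_adj (block par1 r1 v1) (block par2 r2 v2)).
- by move=> x y; exact: block_rel.
- by move=> x y; exact: block_rel.
by move=> k; rewrite !card_block// E.
Qed.

(** Only the edge between the centres changes direction: [r] gets the parent [v], and the old value
    at [v] becomes junk. This makes the two centres interchangeable. *)
Lemma double_star_reroot par r v : double_star par r v ->
  exists par', [/\ double_star par' v r, parent_rel par' v =2 parent_rel par r &
    pdeg par' v r = pdeg par r r].
Proof.
move=> ds; have [vr pv H] := ds; have rv : r != v by rewrite eq_sym.
pose par' z := if z == r then v else par z.
have ds' : double_star par' v r.
  split; rewrite /par' ?eqxx // => z zv.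
  by case: ifP => [|/negbT zr]; [left|case: (H _ zr) => ->; [right|left]].
have E : parent_rel par' v =2 parent_rel par r.
  move=> x y; rewrite /parent_rel /par'.
  have [->|xr] := eqVneq x r; have [->|yr] := eqVneq y r;
    rewrite /= ?rv ?(negbTE rv) ?andbF ?orbF //=.
  - by rewrite (negbTE vr).
  - by have [->|yv] := eqVneq y v; rewrite ?pv ?eqxx.
  - by have [->|xv] := eqVneq x v; rewrite ?pv ?eqxx //= ?orbF.
  have [->|xv] := eqVneq x v; have [->|yv] := eqVneq y v;
    by rewrite /= ?pv ?[r == _]eq_sym ?(negbTE xr) ?(negbTE yr) ?(negbTE vr).
exists par'; split => //.
rewrite -!deg_parent_rel; [|exact: double_star_rooted ds|exact: double_star_rooted ds'].
by apply: eq_card => y; rewrite !inE E.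
Qed.

End Isomorphism.

(* Locked, since otherwise a failed unification of two radii unfolds matrices,
   eigenvalues and suprema. *)
HB.lock Definition sombor_radius {R : realType} (p : R) {n : nat} (e : rel 'I_n) : R :=
  rho (sombor_mx p e).

Lemma sombor_radiusE (R : realType) (p : R) n (e : rel 'I_n) :
  rho (sombor_mx p e) = sombor_radius p e.
Proof. by rewrite sombor_radius.unlock. Qed.

(** * Quadratic form and Perron vector of a rooted tree *)

Section SomborForm.
Variables (R : realType) (p : R) (n : nat).
Hypothesis p1 : 1 <= p.
Implicit Types (r x y z u v w : 'I_n) (par : 'I_n -> 'I_n) (e : rel 'I_n).
Implicit Types f g : 'I_n -> R.

Definition edge_weight par r z : R :=
  weight p (pdeg par r z)%:R (pdeg par r (par z))%:R.
(** Half of the quadratic form: each edge appears once, indexed by its child end. *)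
Definition edge_form par r f : R :=
  \sum_(z | z != r) edge_weight par r z * (f z * f (par z)).
Definition perron par r f : Prop :=
  (forall i, 0 < f i) /\ forall i,
    (if i != r then edge_weight par r i * f (par i) else 0) +
    \sum_(c in children par r i) edge_weight par r c * f c =
    sombor_radius p (parent_rel par r) * f i.

Lemma eq_sombor_mx e1 e2 : e1 =2 e2 -> sombor_mx p e1 = sombor_mx p e2.
Proof.
move=> E; apply/matrixP => i j; rewrite !mxE E /deg.
have H x : #|[pred y | e1 x y]| = #|[pred y | e2 x y]|.
  by apply: eq_card => y; rewrite !inE E.
by rewrite !H.
Qed.

Lemma eq_sombor_radius e1 e2 : e1 =2 e2 -> sombor_radius p e1 = sombor_radius p e2.
Proof. by move=> E; rewrite -!sombor_radiusE (eq_sombor_mx E). Qed.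

Lemma sombor_mx_ge0 e i j : 0 <= sombor_mx p e i j.
Proof. by rewrite mxE; case: ifP => // _; exact: powR_ge0. Qed.

Lemma tr_sombor_mx e : symmetric e -> (sombor_mx p e)^T = sombor_mx p e.
Proof. by move=> sE; apply/matrixP => i j; rewrite !mxE sE addrC. Qed.

(** The nonnegative eigenvector of the first graph, carried along the permutation, is a test vector
    for the second. Equality follows by symmetry. *)
Lemma iso_rho_le e1 e2 : (0 < n)%N -> symmetric e1 -> symmetric e2 ->
  graph_iso e1 e2 -> sombor_radius p e1 <= sombor_radius p e2.
Proof.
move=> n0 s1 s2 [s E].
have dE x : deg e1 x = deg e2 (s x).
  rewrite /deg -!sum1_card [RHS](reindex_inj (@perm_inj _ s)) /=.
  by apply: eq_bigl => y; rewrite !inE E.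
have [f [f0 [i0 fi0] Hf]] := rho_ge0_eigenvector n0 (tr_sombor_mx s1) (sombor_mx_ge0 e1).
have sq0 : 0 < \sum_i f i ^+ 2.
  rewrite (bigD1 i0) //= ltr_pwDl ?sumr_ge0// => [|i _]; last exact: sqr_ge0.
  by rewrite exprn_gt0// lt_neqAle eq_sym fi0 f0.
have rE : \sum_i f i ^+ 2 = \sum_i f ((s^-1)%g i) ^+ 2.
  by rewrite [RHS](reindex_inj (@perm_inj _ s)) /=; apply: eq_bigr => i _; rewrite permK.
rewrite -!sombor_radiusE -(ler_pM2r sq0) {2}rE.
apply: le_trans (le_rho n0 (tr_sombor_mx s2) _).
rewrite le_eqVlt; apply/orP; left; apply/eqP.
rewrite mulr_sumr [RHS](reindex_inj (@perm_inj _ s)) /=.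
apply: eq_bigr => i _; rewrite expr2 mulrA -Hf mulr_suml.
rewrite [RHS](reindex_inj (@perm_inj _ s)) /=.
by apply: eq_bigr => j _; rewrite !permK !mxE E !dE; ring.
Qed.

Lemma iso_rho e1 e2 : (0 < n)%N -> symmetric e1 -> symmetric e2 ->
  graph_iso e1 e2 -> sombor_radius p e1 = sombor_radius p e2.
Proof.
move=> n0 s1 s2 E; apply/eqP; rewrite eq_le !iso_rho_le //.
exact: graph_iso_sym.
Qed.

Lemma edge_weight_ge0 par r z : 0 <= edge_weight par r z.
Proof. exact: weight_ge0. Qed.

Lemma pdeg_gt0 par r z : z != r -> (0 < pdeg par r z)%N.
Proof. by rewrite /pdeg => ->; rewrite addn1. Qed.

Lemma sombor_row par r f i : rooted par r ->
  \sum_j sombor_mx p (parent_rel par r) i j * f j =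
  (if i != r then edge_weight par r i * f (par i) else 0) +
  \sum_(c in children par r i) edge_weight par r c * f c.
Proof.
move=> rt.
have -> : \sum_j sombor_mx p (parent_rel par r) i j * f j =
  \sum_(j | parent_rel par r i j) weight p (pdeg par r i)%:R (pdeg par r j)%:R * f j.
  rewrite [RHS]big_mkcond; apply: eq_bigr => j _; rewrite mxE weightE !(deg_parent_rel _ rt).
  by case: ifP => _; rewrite ?mul0r.
rewrite big_parent_rel//; congr (_ + _).
by apply: eq_bigr => c; rewrite inE /edge_weight => /andP[_ /eqP ->]; rewrite weightC.
Qed.

Lemma sombor_form par r f : rooted par r ->
  \sum_i \sum_j sombor_mx p (parent_rel par r) i j * (f i * f j) =
  2 * edge_form par r f.
Proof.
move=> rt.
have -> : \sum_i \sum_j sombor_mx p (parent_rel par r) i j * (f i * f j) =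
    \sum_i f i * \sum_j sombor_mx p (parent_rel par r) i j * f j.
  apply: eq_bigr => i _; rewrite mulr_sumr; apply: eq_bigr => j _; ring.
under eq_bigr => i _ do rewrite sombor_row// mulrDr.
rewrite big_split /= mulr_natl mulr2n; congr (_ + _).
  rewrite /edge_form [RHS]big_mkcond; apply: eq_bigr => i _.
  by case: ifP => _; rewrite ?mulr0//; ring.
under eq_bigr => i _ do rewrite mulr_sumr.
rewrite (exchange_big_dep (fun c => c != r)) /= => [|i c _]; last by rewrite inE => /andP[].
apply: eq_bigr => c cr; rewrite (big_pred1 (par c)) => [|i]; first by ring.
by rewrite /= inE cr eq_sym.
Qed.

Lemma parent_rel_sym par r : symmetric (parent_rel par r).
Proof. by move=> x y; exact: parent_relC. Qed.

(** Irreducibility by hand: a zero entry forces zeros at all neighbours, since the eigenvalue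
    equation then equates a sum of nonnegative terms to 0. Zeros thus travel up to the root and from
    there to every vertex. *)
Lemma perron_exists par r : rooted par r -> exists f, perron par r f.
Proof.
move=> rt; have n0 : (0 < n)%N := leq_ltn_trans (leq0n r) (ltn_ord r).
have [f [f0 [i0 fi0] Hf]] := rho_ge0_eigenvector n0
  (tr_sombor_mx (@parent_rel_sym par r)) (sombor_mx_ge0 (parent_rel par r)).
exists f; split => [|i]; last by rewrite -sombor_row// -sombor_radiusE.
have nb i j : parent_rel par r i j -> f i = 0 -> f j = 0.
  move=> ij fi; have := Hf i; rewrite fi mulr0 => /eqP.
  rewrite psumr_eq0 => [/allP/(_ j)|k _]; last by rewrite mulr_ge0 ?sombor_mx_ge0.
  rewrite mem_index_enum => /(_ isT) /=.
  rewrite mxE ij weightE mulf_eq0 => /orP[|/eqP//]; rewrite !deg_parent_rel//.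
  rewrite gt_eqF//; case/orP: ij => /andP[nr _]; last rewrite weightC;
    by rewrite weight_gt0// ltr0n pdeg_gt0.
have up i : i != r -> f i = 0 <-> f (par i) = 0.
  by move=> ir; split; apply: nb; rewrite /parent_rel ir !eqxx // orbT.
have toroot i : f i = 0 <-> f r = 0.
  case: rt => h hP; have [k] := ubnP (h i); elim: k i => // k IH i hi.
  have [->//|ir] := eqVneq i r; rewrite (up i ir); apply: IH.
  by apply: leq_trans (hP _ ir) _.
move=> i; rewrite lt_neqAle f0 andbT eq_sym; apply: contra fi0 => /eqP/toroot fr.
exact/eqP/toroot.
Qed.

(** The comparison principle behind every strict step: [f] attains the first radius, and [g] has the
    same norm and bounds the second radius from below. *)
Lemma perron_lt par1 par2 r1 r2 f g : rooted par1 r1 -> rooted par2 r2 ->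
  perron par1 r1 f -> \sum_i g i ^+ 2 = \sum_i f i ^+ 2 ->
  edge_form par1 r1 f < edge_form par2 r2 g ->
  sombor_radius p (parent_rel par1 r1) < sombor_radius p (parent_rel par2 r2).
Proof.
move=> rt1 rt2 [f0 Hf] gf lt; have n0 : (0 < n)%N := leq_ltn_trans (leq0n r1) (ltn_ord r1).
have sq0 : 0 < \sum_i f i ^+ 2.
  rewrite (bigD1 r1) //= ltr_pwDl ?exprn_gt0 ?sumr_ge0// => i _; exact: sqr_ge0.
rewrite -(ltr_pM2r sq0) -{2}gf.
have := le_rho n0 (tr_sombor_mx (@parent_rel_sym par2 r2)) g.
rewrite sombor_radiusE; apply: lt_le_trans.
rewrite sombor_form//; apply: le_lt_trans (_ : 2 * edge_form par1 r1 f < _).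
  rewrite -sombor_form// mulr_sumr; apply: ler_sum => i _.
  rewrite expr2 mulrA -Hf -sombor_row// mulr_suml.
  by apply: ler_sum => j _; rewrite [f i * _]mulrC mulrA.
by rewrite ltr_pM2l.
Qed.

End SomborForm.

(** * Edge contraction and leaf moving *)

Section Contraction.
Variable n : nat.
Variables (par : 'I_n -> 'I_n) (r v : 'I_n).
Hypotheses (rt : rooted par r) (vr : v != r).
Implicit Types x y z : 'I_n.

(* The vertex set is kept: v becomes a leaf attached to the merged vertex. *)
Definition contract z := if par z == v then par v else par z.

Let uv : par v != v. Proof. exact: rooted_irr rt vr. Qed.

Lemma contract_neq z : contract z != v.
Proof. by rewrite /contract; case: ifP => // /negbT. Qed.

Lemma contract_id : contract v = par v.
Proof. by rewrite /contract; case: ifP. Qed.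

(** The old height still decreases, because a redirected vertex is sent to its grandparent. *)
Lemma contract_rooted : rooted contract r.
Proof.
case: rt => h hP; exists h => x xr; rewrite /contract; case: ifP => [/eqP E|_]; last exact: hP.
by apply: ltn_trans (hP _ vr) _; rewrite -E; exact: hP.
Qed.

Lemma children_contract_v : children contract r v = set0.
Proof. by apply/setP => c; rewrite !inE (negbTE (contract_neq c)) andbF. Qed.

Lemma children_contract_u :
  children contract r (par v) = children par r (par v) :|: children par r v.
Proof.
apply/setP => c; rewrite !inE /contract; case: ifP => [_|_].
  by rewrite eqxx /= orbC; case: (c == r).
by rewrite andbF orbF.
Qed.

Lemma children_contract z : z != v -> z != par v ->
  children contract r z = children par r z.
Proof.
move=> zv zu; apply/setP => c; rewrite !inE /contract; case: ifP => [/eqP ->|//].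
by rewrite ![_ == z]eq_sym (negbTE zv) (negbTE zu).
Qed.

Lemma card_children_contract_u :
  #|children contract r (par v)| = (#|children par r (par v)| + #|children par r v|)%N.
Proof.
rewrite children_contract_u cardsU (_ : _ :&: _ = set0) ?cards0 ?subn0//.
apply/setP => c; rewrite !inE; apply/negP => /and3P[/andP[_ /eqP ->] _].
by rewrite (negbTE uv).
Qed.

Lemma pdeg_contract_v : pdeg contract r v = 1%N.
Proof. by rewrite /pdeg children_contract_v cards0 vr. Qed.

Lemma pdeg_contract_u :
  (pdeg contract r (par v) + 1 = pdeg par r (par v) + pdeg par r v)%N.
Proof. by rewrite /pdeg card_children_contract_u vr; lia. Qed.

Lemma pdeg_contract z : z != v -> z != par v -> pdeg contract r z = pdeg par r z.
Proof. by move=> zv zu; rewrite /pdeg children_contract. Qed.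

Lemma internal_contract : internal contract r = internal par r :\ v.
Proof.
apply/setP => z; rewrite in_setD1 !inE.
have [->|zv] /= := eqVneq z v; first by rewrite children_contract_v eqxx andbF.
have [->|zu] := eqVneq z (par v); last by rewrite children_contract.
have vu : v \in children par r (par v) by exact: mem_children.
have vu' : v \in children contract r (par v) by rewrite children_contract_u inE vu.
congr (_ && _); transitivity true; first by apply/set0Pn; exists v.
by apply/esym/set0Pn; exists v.
Qed.

(** The two conditions say that neither end of the contracted edge is a leaf; otherwise the
    contracted tree would be isomorphic to the old one. *)
Lemma contract_rho (R : realType) (p : R) : 1 <= p ->
  (1 < pdeg par r (par v))%N -> children par r v != set0 ->
  sombor_radius p (parent_rel par r) < sombor_radius p (parent_rel contract r).
Proof.
move=> p1 du /set0Pn [c]; rewrite inE => /andP[cr /eqP pc].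
have rt' := contract_rooted.
have [f pf] := perron_exists p1 rt; have [f0 _] := pf.
pose u := par v.
(* The merged vertex inherits the edges of both ends, so its entry has to dominate both old entries;
   the exchange leaves the norm and the product on the contracted edge unchanged. *)
have [g [gu gv gm gE gS]] : exists g : 'I_n -> R,
    [/\ f u <= g u, f v <= g u, g v * g u = f v * f u,
      forall z, z != u -> z != v -> g z = f z & \sum_i g i ^+ 2 = \sum_i f i ^+ 2].
  have [le|lt] := leP (f v) (f u); first by exists f; split.
  exists (fun z => f (tperm u v z)); split.
  - by rewrite tpermL ltW.
  - by rewrite tpermL.
  - by rewrite tpermL tpermR mulrC.
  - by move=> z zu zv; rewrite tpermD // eq_sym.
  by rewrite [RHS](reindex_inj (@perm_inj _ (tperm u v))).
apply: (perron_lt rt rt' pf gS).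
have dv : (0 < pdeg par r v)%N by rewrite pdeg_gt0.
have du' := pdeg_contract_u.
have fg z : z != v -> f z <= g z.
  move=> zv; have [->|zu] := eqVneq z u; first exact: gu.
  by rewrite gE.
have fpg z : f (par z) <= g (contract z).
  rewrite /contract; case: ifP => [/eqP -> //|/negbT]; exact: fg.
have dd z : z != v -> (pdeg par r z <= pdeg contract r z)%N.
  move=> zv; have [->|zu] := eqVneq z u; last by rewrite pdeg_contract.
  by rewrite /u; lia.
have dpd z : (pdeg par r (par z) <= pdeg contract r (contract z))%N.
  rewrite {2}/contract; case: ifP => [/eqP -> |/negbT]; last exact: dd.
  by lia.
have main z : z != v -> edge_weight p par r z * (f z * f (par z)) <=
    edge_weight p contract r z * (g z * g (contract z)).
  move=> zv; apply: ler_pM; rewrite ?edge_weight_ge0 ?mulr_ge0 ?(ltW (f0 _))//.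
    by apply: le_weight => //; rewrite ?ler0n// ler_nat//; exact: dd.
  by apply: ler_pM; rewrite ?(ltW (f0 _))//; exact: fg.
have cv : c != v by have := rooted_irr rt cr; rewrite pc eq_sym.
(* The edge above [c] gives strictness: its upper end passes from the degree of [v] to that of the
   merged vertex, which is larger since [par v] has degree at least 2. *)
rewrite /edge_form (bigD1 c) //= [ltRHS](bigD1 c) //=; apply: ltr_leD.
  have wlt : edge_weight p par r c < edge_weight p contract r c.
    rewrite /edge_weight ![weight _ (pdeg _ _ c)%:R _]weightC.
    apply: lt_weight => //; rewrite ?ler0n// ?ltr_nat ?ler_nat; last exact: dd.
    by rewrite {2}/contract pc eqxx; lia.
  apply: lt_le_trans (_ : edge_weight p contract r c * (f c * f (par c)) <= _).
    by rewrite ltr_pM2r// mulr_gt0.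
  apply: ler_wpM2l; first exact: edge_weight_ge0.
  by apply: ler_pM; rewrite ?(ltW (f0 _))//; exact: fg.
apply: ler_sum => z /andP[zr zc].
have [->|zv] := eqVneq z v; last exact: main.
(* On the contracted edge the two degrees move apart with constant sum, one of them becoming 1. *)
rewrite contract_id gm; apply: ler_wpM2r; first by rewrite mulr_ge0 ?(ltW (f0 _)).
rewrite /edge_weight contract_id pdeg_contract_v.
apply: weight_majorize => //; rewrite ?ler0n ?ler1n ?ler_nat ?pdeg_gt0//; first by lia.
by rewrite -natrD addnC du' addnC natrD.
Qed.

End Contraction.

Section MovingABranch.
Variable n : nat.
Variables (par : 'I_n -> 'I_n) (r z0 w : 'I_n).
Hypotheses (z0r : z0 != r) (wv : w != par z0).
Implicit Types x y z : 'I_n.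

Definition move z := if z == z0 then w else par z.

Lemma children_move_v : children move r (par z0) = children par r (par z0) :\ z0.
Proof.
apply/setP => c; rewrite in_setD1 !inE /move.
by have [->|cz] := eqVneq c z0; rewrite ?(negbTE wv) ?andbF.
Qed.

Lemma children_move_w : children move r w = z0 |: children par r w.
Proof.
apply/setP => c; rewrite in_setU1 !inE /move.
by have [->|cz] := eqVneq c z0; rewrite ?z0r ?eqxx.
Qed.

Lemma children_move z : z != par z0 -> z != w -> children move r z = children par r z.
Proof.
move=> zv zw; apply/setP => c; rewrite !inE /move.
have [->|//] := eqVneq c z0.
by rewrite ![_ == z]eq_sym (negbTE zv) (negbTE zw).
Qed.

Lemma pdeg_move_v : (pdeg move r (par z0)).+1 = pdeg par r (par z0).
Proof.
by rewrite /pdeg children_move_v (cardsD1 z0 (children par r (par z0))) mem_children.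
Qed.

Lemma pdeg_move_w : pdeg move r w = (pdeg par r w).+1.
Proof.
by rewrite /pdeg children_move_w cardsU1 inE z0r /= eq_sym wv.
Qed.

Lemma pdeg_move z : z != par z0 -> z != w -> pdeg move r z = pdeg par r z.
Proof. by move=> zv zw; rewrite /pdeg children_move. Qed.

End MovingABranch.

(** Only the edges above [par l], [w] and [l] need an estimate; on all others no degree falls. The
    Perron vector itself is the test vector. *)
Lemma move_rho (R : realType) (p : R) n (par : 'I_n -> 'I_n) (r l w : 'I_n) f :
  1 <= p -> rooted par r -> perron p par r f ->
  l != r -> par l != r -> w != r -> w != par l ->
  par (par l) = r -> par w = r ->
  pdeg par r (par l) = 2%N -> pdeg par r w = 2%N ->
  rooted (move par l w) r -> f (par l) <= f w ->
  sombor_radius p (parent_rel par r) <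
  sombor_radius p (parent_rel (move par l w) r).
Proof.
move=> p1 rt pf lr vr wr wv pv pw dv dw rt' fvw; have [f0 _] := pf.
have lv : par l != l := rooted_irr rt lr.
have lw : l != w by apply: contraNneq vr => ->; rewrite pw.
have lpv : par (par l) != l by exact: rooted_asym rt lr erefl vr.
have dv' : pdeg (move par l w) r (par l) = 1%N.
  by have := pdeg_move_v lr wv; rewrite dv => -[].
have dw' : pdeg (move par l w) r w = 3%N by rewrite pdeg_move_w// dw.
have mN z : z != l -> move par l w z = par z by rewrite /move => /negbTE ->.
have ml : move par l w l = w by rewrite /move eqxx.
have dr' : pdeg (move par l w) r r = pdeg par r r.
  by rewrite pdeg_move// eq_sym.
have dl' : pdeg (move par l w) r l = pdeg par r l by rewrite pdeg_move// eq_sym.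
apply: (perron_lt rt rt' pf (erefl _)); rewrite /edge_form.
rewrite (bigD1 (par l)) //= (bigD1 w) /=; last by rewrite wr wv.
rewrite (bigD1 l) /=; last by rewrite lr eq_sym lv lw.
rewrite [ltRHS](bigD1 (par l)) //= [X in _ < _ + X](bigD1 w) /=; last by rewrite wr wv.
rewrite [X in _ < _ + (_ + X)](bigD1 l) /=; last by rewrite lr eq_sym lv lw.
rewrite !addrA; apply: ltr_leD.
  rewrite /edge_weight ml !mN ?[w == l]eq_sym// pv pw dv dw dv' dw' dr' dl'.
  set c : R := (pdeg par r r)%:R; set d : R := (pdeg par r l)%:R.
  have c0 : 0 < c.
    rewrite ltr0n /pdeg eqxx addn0 card_gt0; apply/set0Pn; exists w.
    by rewrite inE wr pw eqxx.
  have inc : weight p 2 c + weight p 2 c <= weight p 1 c + weight p 3 c.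
    by apply: weight_incr => //; lra.
  have w23 : weight p 2 c <= weight p 3 c by apply: le_weight => //; lra.
  have w12 : weight p 1 c <= weight p 2 c by apply: le_weight => //; lra.
  have wl : weight p d 2 < weight p d 3.
    by rewrite ![weight p d _]weightC; apply: lt_weight => //; rewrite ?ler0n//; lra.
  have fl := f0 l; have fv := f0 (par l); have fr := f0 r.
  have wl0 := weight_ge0 p d 2.
  (* The loss at [par l] is at most the gain at [w], by convexity of the weight and because the
     entry at [w] is the larger one. The edge above [l] then gives strictness. *)
  apply: ler_ltD.
    rewrite !mulrA -!mulrDl ler_pM2r//.
    by move: inc w23 w12 fvw fv; nra.
  apply: le_lt_trans (_ : weight p d 2 * (f l * f w) < _).
    by rewrite ler_wpM2l// ler_pM2l.
  by rewrite ltr_pM2r// mulr_gt0.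
apply: ler_sum => z /andP[/andP[/andP[zr zv] zw] zl].
rewrite mN// ler_wpM2r ?mulr_ge0 ?(ltW (f0 _))//.
apply: le_weight => //; rewrite ?ler0n// ler_nat ?mN//.
  by rewrite pdeg_move.
(* As [par l] has degree 2, [l] is its only child, so no other edge hangs from the vertex whose
   degree drops. *)
have pzv : par z != par l.
  apply: contraNneq zl => E.
  have : #|children par r (par l)| = 1%N by move: dv; rewrite /pdeg vr; lia.
  move/eqP/cards1P => [c Ec].
  have := mem_children par zr; have := mem_children par lr.
  by rewrite E Ec !inE => /eqP -> /eqP ->.
have [->|pzw] := eqVneq (par z) w; first by rewrite pdeg_move_w.
by rewrite pdeg_move.
Qed.

(** * Shifting a leaf between the centres of a double star *)

Section DoubleStarStep.
Variables (R : realType) (p : R) (n : nat).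
Hypothesis p1 : 1 <= p.
Variables (par : 'I_n -> 'I_n) (r v : 'I_n).
Hypothesis ds : double_star par r v.

Let vr : v != r. Proof. by case: ds. Qed.
Let pv : par v = r. Proof. by case: ds. Qed.
Let vcr : v \in children par r r. Proof. by rewrite inE vr pv eqxx. Qed.

Lemma pdeg_leaf c : c != r -> c != v -> pdeg par r c = 1%N.
Proof. by move=> cr cv; rewrite /pdeg (double_star_children ds)// cards0 cr. Qed.

Lemma child_neq c : c \in children par r v -> c != r /\ c != v.
Proof.
rewrite inE => /andP[cr /eqP pc]; split => //.
by have := rooted_irr (double_star_rooted ds) cr; rewrite pc eq_sym.
Qed.

Lemma double_star_form (f : 'I_n -> R) : edge_form p par r f =
  weight p (pdeg par r v)%:R (pdeg par r r)%:R * (f v * f r) +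
  \sum_(c in children par r v) weight p 1 (pdeg par r v)%:R * (f c * f v) +
  \sum_(c in children par r r :\ v) weight p 1 (pdeg par r r)%:R * (f c * f r).
Proof.
rewrite /edge_form (bigD1 v) //= {1}/edge_weight pv -addrA; congr (_ + _).
rewrite (bigID (fun c => par c == v)) /=; congr (_ + _).
  apply: eq_big => c.
    rewrite inE; have [->|cv] := eqVneq c v; last by rewrite andbT.
    by rewrite pv andbF eq_sym (negbTE vr) andbF.
  by move=> /andP[/andP[cr cv] /eqP E]; rewrite /edge_weight E pdeg_leaf.
apply: eq_big => c.
  rewrite in_setD1 inE andbC; have [->|cv] := eqVneq c v; first by rewrite /= !andbF.
  rewrite /= andbT; have [//|cr] := eqVneq c r; first by rewrite andbF.
  case: ds => _ _ /(_ _ cr) [] ->; rewrite ?eqxx ?[r == v]eq_sym ?(negbTE vr) //.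
move=> /andP[/andP[cr cv] cN]; have E : par c = r.
  by case: ds => _ _ /(_ _ cr) [] // E; rewrite E eqxx in cN.
by rewrite /edge_weight E pdeg_leaf.
Qed.

Lemma card_children_r : #|children par r r :\ v|.+1 = pdeg par r r.
Proof. by rewrite /pdeg eqxx addn0 (cardsD1 v (children par r r)) vcr. Qed.

Lemma card_children_v : #|children par r v|.+1 = pdeg par r v.
Proof. by rewrite /pdeg vr addn1. Qed.

(* X, Y are the Perron entries of the two centres, yv and yr those of their
   leaves. *)
Lemma double_star_ineq (K M X Y yv yr rh a b g a' b' g' : R) :
  0 <= K -> K + 1 <= M -> 0 < X -> 0 < Y -> 0 < yv -> 0 < yr -> 0 < rh ->
  0 < a -> a <= b -> 0 < g -> a' <= a -> a - a' <= b' - b -> b < b' -> g <= g' ->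
  a * X = rh * yv -> b * Y = rh * yr ->
  g * Y + (K + 1) * a * yv = rh * X -> g * X + M * b * yr = rh * Y ->
  g * (X * Y) + (K + 1) * (a * (yv * X)) + M * (b * (yr * Y)) <
  g' * (X * Y) + K * (a' * (yv * X)) + M * (b' * (yr * Y)) + b' * (yv * Y).
Proof.
move=> K0 KM X0 Y0 yv0 yr0 r0 a0 ab g0 a'a inc bb gg eA eB eV eR.
have b0 : 0 < b by lra.
(* The centre with more leaves has the larger entry. Eliminating the leaf entries expresses
   [rh * g * Y^2] and [rh * g * X^2] as [rh^2 * X * Y] minus [(K + 1) * a^2 * X * Y] and
   [M * b^2 * X * Y] respectively. *)
have XY : X <= Y.
  have aabb : (K + 1) * (a * a) <= M * (b * b).
    by apply: ler_pM; [lra|rewrite mulr_ge0// ltW|lra|apply: ler_pM; lra].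
  have : rh * g * (X * X) <= rh * g * (Y * Y).
    have e1 : rh * g * (Y * Y) = rh * rh * (X * Y) - (K + 1) * (a * a) * (X * Y).
      have -> : rh * g * (Y * Y) = rh * Y * (g * Y) by ring.
      have -> : g * Y = rh * X - (K + 1) * a * yv by lra.
      have -> : rh * Y * (rh * X - (K + 1) * a * yv) =
        rh * rh * (X * Y) - (K + 1) * a * Y * (rh * yv) by ring.
      by rewrite -eA; ring.
    have e2 : rh * g * (X * X) = rh * rh * (X * Y) - M * (b * b) * (X * Y).
      have -> : rh * g * (X * X) = rh * X * (g * X) by ring.
      have -> : g * X = rh * Y - M * b * yr by lra.
      have -> : rh * X * (rh * Y - M * b * yr) =
        rh * rh * (X * Y) - M * b * X * (rh * yr) by ring.
      by rewrite -eB; ring.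
    by rewrite e1 e2 lerD2l lerN2 ler_pM2r// mulr_gt0.
  rewrite ler_pM2l ?mulr_gt0// => h; rewrite leNgt; apply/negP => lt.
  by have := ltr_pM (ltW Y0) (ltW Y0) lt lt; lra.
have yy : yv <= yr.
  rewrite -(ler_pM2l r0) -eA -eB; apply: ler_pM; lra.
have yXY : yv * X <= yr * Y by apply: ler_pM; lra.
have d0 : 0 <= a - a' by lra.
have t1 : g * (X * Y) <= g' * (X * Y) by rewrite ler_wpM2r// mulr_ge0// ltW.
(* The loss on the [K] leaves that stay is paid by the gain on the [M] leaves of the other
   centre. *)
have t2 : K * ((a - a') * (yv * X)) <= M * ((b' - b) * (yr * Y)).
  apply: ler_pM; [lra|by rewrite !mulr_ge0// ltW|lra|].
  by apply: ler_pM; [lra|by rewrite mulr_ge0// ltW|lra|].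
have t3 : a * (yv * X) < b' * (yv * Y).
  apply: lt_le_trans (_ : b' * (yv * X) <= _).
    by rewrite ltr_pM2r ?mulr_gt0//; lra.
  by rewrite ler_pM2l ?ler_pM2l//; lra.
by lra.
Qed.

End DoubleStarStep.

Lemma double_star_step (R : realType) (p : R) n (par : 'I_n -> 'I_n) (r v : 'I_n) :
  1 <= p -> double_star par r v -> (1 < pdeg par r v <= pdeg par r r)%N ->
  exists2 par', double_star par' r v /\ (pdeg par' r v).+1 = pdeg par r v &
  sombor_radius p (parent_rel par r) < sombor_radius p (parent_rel par' r).
Proof.
move=> p1 ds /andP[a1 ab].
have [vr pv _] := ds.
have rt := double_star_rooted ds.
have [z0 z0v] : exists z0, z0 \in children par r v.
  by apply/set0Pn; rewrite -card_gt0; move: a1; rewrite -(card_children_v ds).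
have [z0r z0nv] := child_neq ds z0v.
have pz0 : par z0 = v by move: z0v; rewrite inE => /andP[_ /eqP].
have rv : r != par z0 by rewrite pz0 eq_sym.
pose par' := move par z0 r.
have ds' : double_star par' r v.
  split => //; first by rewrite /par' /move eq_sym (negbTE z0nv).
  move=> z zr; rewrite /par' /move; case: ifP => _; first by left.
  by case: ds => _ _; exact.
have dv' : (pdeg par' r v).+1 = pdeg par r v.
  by have := pdeg_move_v z0r rv; rewrite pz0.
have dr' : pdeg par' r r = (pdeg par r r).+1 by rewrite /par' pdeg_move_w.
exists par'; first by split.
have rt' := double_star_rooted ds'.
have [f pf] := perron_exists p1 rt; have [f0 ev] := pf.
apply: (perron_lt rt rt' pf (erefl _)).
have cv' : children par' r v = children par r v :\ z0.
  by rewrite -pz0 /par' children_move_v.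
have cr' : children par' r r :\ v = z0 |: (children par r r :\ v).
  apply/setP => c; rewrite /par' children_move_w// !inE.
  by have [->|_] := eqVneq c z0; rewrite ?z0nv.
have z0N : z0 \notin children par r r :\ v by rewrite !inE pz0 (negbTE vr) !andbF.
rewrite (double_star_form p ds) (double_star_form p ds') cv' cr' big_setU1//= dr'.
set rh := sombor_radius _ _ in ev.
set a := weight p 1 (pdeg par r v)%:R; set b := weight p 1 (pdeg par r r)%:R.
set g := weight p (pdeg par r v)%:R (pdeg par r r)%:R.
set a' := weight p 1 (pdeg par' r v)%:R.
set b' := weight p 1 (pdeg par r r).+1%:R.
set g' := weight p (pdeg par' r v)%:R (pdeg par r r).+1%:R.
have leafv c : c \in children par r v -> a * f v = rh * f c.
  move=> cv; have [cr cnv] := child_neq ds cv; have := ev c.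
  rewrite (double_star_children ds cr cnv) big_set0 addr0 cr /edge_weight.
  by move: cv; rewrite inE cr => /eqP ->; rewrite (pdeg_leaf ds).
have leafr c : c \in children par r r :\ v -> b * f r = rh * f c.
  rewrite !inE => /and3P[cnv cr /eqP pc]; have := ev c.
  by rewrite (double_star_children ds cr cnv) big_set0 addr0 cr /edge_weight pc (pdeg_leaf ds).
have a0 : 0 < a by apply: weight_gt0.
have b0 : 0 < b by apply: weight_gt0.
have rh0 : 0 < rh.
  by rewrite -(pmulr_lgt0 _ (f0 z0)) -leafv// mulr_gt0.
have rn : rh != 0 by rewrite gt_eqF.
(* By the eigenvalue equation at a leaf, all leaves of one centre share the same entry. *)
pose yv := a * f v / rh; pose yr := b * f r / rh.
have yvE c : c \in children par r v -> f c = yv.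
  by move=> /leafv; rewrite /yv => ->; rewrite mulrC mulKf.
have yrE c : c \in children par r r :\ v -> f c = yr.
  by move=> /leafr; rewrite /yr => ->; rewrite mulrC mulKf.
have sumv (A : {set 'I_n}) (F : R -> R) : A \subset children par r v ->
    \sum_(c in A) F (f c) = #|A|%:R * F yv.
  move=> /subsetP sA; rewrite (eq_bigr (fun=> F yv)) ?sumr_const ?mulr_natl// => c cA.
  by rewrite (yvE _ (sA _ cA)).
have sumr (F : R -> R) : \sum_(c in children par r r :\ v) F (f c) =
    #|children par r r :\ v|%:R * F yr.
  by rewrite (eq_bigr (fun=> F yr)) ?sumr_const ?mulr_natl// => c cA; rewrite (yrE _ cA).
rewrite (sumv _ (fun y => a * (y * f v)) (subxx _)).
rewrite (sumv _ (fun y => a' * (y * f v)) (subD1set _ _)).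
rewrite (sumr (fun y => b * (y * f r))) (sumr (fun y => b' * (y * f r))) (yvE _ z0v).
have EV := ev v; rewrite vr /= in EV.
have ER := ev r; rewrite eqxx /= add0r (big_setD1 v) /= in ER; last first.
  by rewrite inE vr pv eqxx.
move: EV ER.
have -> : edge_weight p par r v = g by rewrite /edge_weight pv.
rewrite pv.
have -> : \sum_(c in children par r v) edge_weight p par r c * f c =
    #|children par r v|%:R * (a * yv).
  rewrite -(sumv _ (fun y => a * y) (subxx _)); apply: eq_bigr => c cv.
  have [cr cnv] := child_neq ds cv; move: cv; rewrite inE cr => /eqP E.
  by rewrite /edge_weight E (pdeg_leaf ds).
have -> : \sum_(c in children par r r :\ v) edge_weight p par r c * f c =
    #|children par r r :\ v|%:R * (b * yr).
  rewrite -(sumr (fun y => b * y)); apply: eq_bigr => c.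
  by rewrite !inE => /and3P[cnv cr /eqP E]; rewrite /edge_weight E (pdeg_leaf ds).
have Ca := card_children_v ds; have Cb := card_children_r ds.
rewrite (cardsD1 z0 (children par r v)) z0v add1n -natr1 => EV ER.
have KM : #|children par r v :\ z0|%:R + 1 <= #|children par r r :\ v|%:R :> R.
  by rewrite natr1 ler_nat; move: ab; rewrite -Ca -Cb (cardsD1 z0) z0v.
have Ha : (pdeg par' r v)%:R + 1 = (pdeg par r v)%:R :> R by rewrite natr1 dv'.
have dv0 : (0 < pdeg par' r v)%N by rewrite -ltnS dv'.
have dvv : (pdeg par' r v <= pdeg par r v)%N by rewrite -dv'.
have dvr : (pdeg par r v <= (pdeg par r r).+1)%N by exact: leqW.
rewrite [X in _ < _ + X]addrC addrA.
apply: (double_star_ineq (rh := rh)) => //.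
- by rewrite divr_gt0// mulr_gt0.
- by rewrite divr_gt0// mulr_gt0.
- by apply: le_weight => //; rewrite ?ler0n// ler_nat.
- by apply: weight_gt0; rewrite ?ltr0n ?ler0n// (leq_trans dv0).
- by apply: le_weight => //; rewrite ?ler0n// ler_nat.
- have : a + b <= a' + b'.
    rewrite /a /b /a' /b' ![weight p 1 _]weightC.
    apply: weight_incr => //; rewrite ?ler0n ?ler_nat//.
    by rewrite -Ha -natr1; ring.
  lra.
- by rewrite /b /b' ![weight p 1 _]weightC; apply: lt_weight => //; rewrite ?ler0n// ltr_nat.
- apply: weight_majorize => //; rewrite ?ler0n ?ler_nat//.
  by rewrite -Ha -natr1; ring.
- by rewrite /yv [RHS]mulrC divfK.
- by rewrite /yr [RHS]mulrC divfK.
- by rewrite -EV; ring.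
by rewrite -ER; ring.
Qed.

(** * From trees to parent maps *)

Lemma card_ord_interval n d : (d < n)%N -> #|[pred z : 'I_n | (1 < z <= d)%N]| = d.-1.
Proof.
move=> dn; rewrite -sum1_card.
transitivity (\sum_(0 <= i < n | (1 < i <= d)%N) 1)%N; first by rewrite big_mkord; apply: eq_bigl.
rewrite big_mkcond /= (big_cat_nat (n := d.+1)) //=.
rewrite [X in (_ + X)%N]big_nat_cond [X in (_ + X)%N]big1 ?addn0 => [|i]; last first.
  by case: ifP => // /andP[_ h2] /andP[/andP[h3 _] _]; lia.
case: d dn => [|d] dn; first by rewrite big_nat1.
rewrite big_ltn// big_ltn// !add0n /= big_nat_cond.
rewrite (eq_bigr (fun=> 1%N)); last by move=> i /andP[/andP[h1 h2] _]; rewrite h1 -ltnS h2.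
by rewrite -big_nat_cond sum_nat_const_nat muln1 subn2.
Qed.

(** The root is vertex 1, so that the non-root centre 0 is the one of degree d. *)
Lemma dstar_double_star n d : (0 < d < n)%N ->
  exists par r v, [/\ double_star par r v, pdeg par r v = d &
    parent_rel par r =2 dstar_rel n d].
Proof.
case: n => [|[|m]]; [by lia|by lia|] => /andP[d0 dm].
pose o0 : 'I_m.+2 := Ordinal (isT : 0 < m.+2)%N.
pose o1 : 'I_m.+2 := Ordinal (isT : 1 < m.+2)%N.
pose par (z : 'I_m.+2) := if (1 < z <= d)%N then o0 else o1.
have ds : double_star par o1 o0.
  by split => // z _; rewrite /par; case: ifP; [right|left].
exists par, o1, o0; split => //.
  rewrite /pdeg addn1 -[RHS](prednK d0); congr _.+1.
  rewrite -(card_ord_interval dm); apply: eq_card => z; rewrite !inE /par.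
  case: ifP => // h; rewrite ?andbT ?andbF//.
  by apply/eqP => E; rewrite E in h.
move=> x y; rewrite /parent_rel /dstar_rel /dstar_half /par -!val_eqE /=.
have H (a b : nat) : (a != 1%N) && (val (if (1 < a <= d)%N then o0 else o1) == b) =
   ((b == 0%N) && (2 <= a <= d)%N) || ((a != 1%N) && (b == 1%N) && ~~ (1 < a <= d)%N).
  by case: ifP => h /=; rewrite ?andbF ?orbF ?andbT /=; lia.
rewrite !H; have := ltn_ord x; have := ltn_ord y; move: (val x) (val y) => a b _ _.
lia.
Qed.

(** A parent is a neighbour closer to [r], with [h] the distance from [r]. An edge outside the
    parent relation would close a simple path of parent edges to a cycle. *)
Lemma tree_parent_rel n (e : rel 'I_n) (r : 'I_n) : is_tree e ->
  exists2 par, rooted par r & e =2 parent_rel par r.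
Proof.
case=> [[sE irr] con acyc].
pose P x k := [exists t : k.-tuple 'I_n, path e r t && (last r t == x)].
have PE x : exists k, P x k.
  have /connectP [t pt lt] := con r x; exists (size t).
  by apply/existsP; exists (in_tuple t); rewrite /= pt lt eqxx.
pose h x := ex_minn (PE x).
have nbr x : x != r -> exists y, e x y && (h y < h x)%N.
  move=> xr; rewrite /h; case: (ex_minnP (PE x)) => k /existsP [t /andP[pt /eqP lt]] _.
  case: k t pt lt => [t|k t].
    by rewrite tuple0 /= => _ E; rewrite E eqxx in xr.
  case/lastP E : (tval t) => [|s y]; first by have := size_tuple t; rewrite E.
  rewrite rcons_path last_rcons => /andP[ps ey] yx.
  exists (last r s); rewrite sE -{1}yx ey /=.
  case: ex_minnP => l _; apply.
  have sk : size s == k by have := size_tuple t; rewrite E size_rcons => -[->].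
  by apply/existsP; exists (Tuple sk); rewrite /= ps eqxx.
(* The default is reached only at the root, where the parent is junk. *)
pose par x := if [pick y | e x y && (h y < h x)%N] is Some y then y else x.
have parP x : x != r -> e x (par x) && (h (par x) < h x)%N.
  move=> xr; rewrite /par; case: pickP => // none.
  by have [y] := nbr _ xr; rewrite none.
have sub : subrel (parent_rel par r) e.
  move=> x y /orP[] /andP[nr /eqP <-]; have /andP[pe _] := parP _ nr => //.
  by rewrite sE.
have symP : connect_sym (parent_rel par r).
  by apply: sym_connect_sym => x y; exact: parent_relC.
have toroot x : connect (parent_rel par r) x r.
  have [k] := ubnP (h x); elim: k x => // k IH x hx.
  have [->|xr] := eqVneq x r; first exact: connect0.
  have /andP[_ hp] := parP _ xr.
  apply: connect_trans (connect1 _) (IH (par x) _); last by lia.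
  by rewrite /parent_rel xr eqxx.
exists par => [|x y]; first by exists h => x xr; have /andP[] := parP _ xr.
apply/idP/idP => [exy|]; last exact: sub.
apply: contraT => N; exfalso; apply: acyc.
have /connectP [s0 ps0] : connect (parent_rel par r) x y.
  by apply: connect_trans (toroot x) _; rewrite symP.
case/shortenP: ps0 => s ps us _ ys.
exists x, s; split => //.
(* A path of length 0 would make the edge a loop, one of length 1 would make it a parent edge. *)
- case: s ps us ys => [|a [|b s]] //=.
    by move=> _ _ E; move: exy; rewrite E (negbTE (irr _)).
  by rewrite andbT => pa _ E; move: N; rewrite E pa.
- exact: sub_path ps.
by rewrite -ys sE.
Qed.

Lemma parent_star_iso n (par : 'I_n -> 'I_n) (r : 'I_n) :
  (forall z, z != r -> par z = r) -> graph_iso (parent_rel par r) (star_rel n).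
Proof.
case: n par r => [par [] //|n] par r H.
exists (tperm r ord0) => x y; rewrite /star_rel /parent_rel (inj_eq perm_inj).
have E z : (val (tperm r ord0 z) == 0%N) = (z == r).
  rewrite -[0%N]/(val (@ord0 n)) val_eqE.
  by rewrite -[X in _ == X](tpermL r ord0) (inj_eq perm_inj).
rewrite !E; have [->|xr] := eqVneq x r; have [->|yr] := eqVneq y r;
  rewrite /= ?eqxx ?H ?eqxx ?orbT ?andbF ?andbT // ?[r == _]eq_sym //.
by rewrite (negbTE xr) (negbTE yr).
Qed.

(** * Comparing all trees with the three extremal ones *)

Section SpectralOrder.
Variables (R : realType) (p : R) (n : nat).
Hypothesis p1 : 1 <= p.
Implicit Types (par : 'I_n -> 'I_n) (r v : 'I_n).

Local Notation S d := (sombor_radius p (dstar_rel n d)).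

Let dstar_sym d : symmetric (dstar_rel n d).
Proof. by move=> x y; rewrite /dstar_rel orbC. Qed.

Lemma double_star_pdeg_bound par r v : double_star par r v ->
  (0 < pdeg par r v < n)%N.
Proof.
move=> ds; have [vr pv _] := ds; rewrite pdeg_gt0//=.
rewrite -[ltnRHS](double_star_pdegD ds) -[ltnLHS]add0n ltn_add2r.
by rewrite -(card_children_r ds).
Qed.

Lemma double_star_dstar_iso par r v : double_star par r v ->
  graph_iso (parent_rel par r) (dstar_rel n (pdeg par r v)).
Proof.
move=> ds; have [par' [r' [v' [ds' E E']]]] := dstar_double_star (double_star_pdeg_bound ds).
apply: graph_iso_trans (eq_graph_iso E').
exact: double_star_iso ds ds' (esym E).
Qed.

Lemma double_star_rho par r v : double_star par r v ->
  sombor_radius p (parent_rel par r) = S (pdeg par r v).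
Proof.
move=> ds; apply: iso_rho; [exact: leq_ltn_trans (leq0n r) (ltn_ord r)| | |].
- exact: parent_rel_sym.
- exact: dstar_sym.
exact: double_star_dstar_iso.
Qed.

Lemma dstar_rho_sym d : (0 < d < n)%N -> S d = S (n - d).
Proof.
move=> /dstar_double_star [par [r [v [ds E _]]]].
have [par' [ds' eqE Er]] := double_star_reroot ds.
have Ed : (n - d = pdeg par' v r)%N.
  by rewrite Er -E -[X in (X - _)%N](double_star_pdegD ds) addnK.
have := double_star_rho ds; rewrite E => <-; have := double_star_rho ds'; rewrite Ed => <-.
by rewrite (eq_sombor_radius p eqE).
Qed.

Lemma dstar_rho_step d : (1 < d)%N -> (d.*2 <= n)%N -> S d < S d.-1.
Proof.
move=> d1 dn; have dd : (0 < d < n)%N by lia.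
have [par [r [v [ds E _]]]] := dstar_double_star dd.
have [|par' [ds' E']] := double_star_step p1 ds.
  by rewrite E d1 /=; have := double_star_pdegD ds; rewrite E; lia.
have Ep : pdeg par' r v = d.-1 by rewrite -E -E'.
by have := double_star_rho ds; rewrite E => ->; have := double_star_rho ds'; rewrite Ep => ->.
Qed.

(** The hypotheses say that both centres have degree at least 3. By symmetry d is at most n/2, and
    single steps lead down to 3. *)
Lemma dstar_rho_le3 d : (3 <= d)%N -> (d + 3 <= n)%N -> S d <= S 3.
Proof.
move=> d3 dn.
have half k : (3 <= k)%N -> (k.*2 <= n)%N -> S k <= S 3.
  elim: k => // k IH k3 kn; have [->|k3'] := eqVneq k 2%N => //.
  by apply: le_trans (ltW (dstar_rho_step _ kn)) (IH _ _); lia.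
have [le|lt] := leqP d.*2 n; first exact: half.
by rewrite dstar_rho_sym; [apply: half|]; lia.
Qed.

Lemma double_star_rho_lt par r v : double_star par r v ->
  (3 < pdeg par r v <= pdeg par r r)%N ->
  sombor_radius p (parent_rel par r) < S 3.
Proof.
move=> ds /andP[v3 vr]; have := double_star_pdegD ds.
rewrite (double_star_rho ds); move: (pdeg par r v) (pdeg par r r) v3 vr => d k v3 vr E.
by apply: lt_le_trans (dstar_rho_step _ _) (dstar_rho_le3 _ _); lia.
Qed.

(** For d = 1 the non-root centre is itself a leaf. The star thus joins the chain of double stars,
    and the top inequality becomes the step from 2 to 1. *)
Lemma star_rho : (1 < n)%N -> sombor_radius p (star_rel n) = S 1.
Proof.
move=> n1; have [par [r [v [ds E _]]]] := dstar_double_star (d := 1) (n := n) n1.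
rewrite -[X in S X]E -(double_star_rho ds); apply/esym/iso_rho.
- exact: leq_ltn_trans n1.
- exact: parent_rel_sym.
- by move=> x y; rewrite /star_rel eq_sym orbC.
apply: parent_star_iso => z zr; have [_ _ /(_ _ zr) [] // pz] := ds.
have := card_children_v ds; rewrite E => -[/eqP]; rewrite cards_eq0 => /eqP E0.
by have := mem_children par zr; rewrite pz E0 inE.
Qed.

Lemma internal_pdeg par r v : v \in internal par r -> (1 < pdeg par r v)%N.
Proof. by rewrite inE /pdeg -card_gt0 => /andP[-> ]; rewrite addn1 ltnS. Qed.

Lemma internal1_double_star par r w : rooted par r -> internal par r = [set w] ->
  double_star par r w.
Proof.
move=> rt I1; have wI : w \in internal par r by rewrite I1 set11.
have wr : w != r by move: wI; rewrite inE => /andP[].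
have H z : z != r -> par z = r \/ par z = w.
  move=> zr; have [|pr] := eqVneq (par z) r; first by left.
  by right; apply/set1P; rewrite -I1; exact: par_internal.
split => //; have [//|E] := H _ wr.
by have := rooted_irr rt wr; rewrite E eqxx.
Qed.

Lemma internal_child par r : rooted par r -> internal par r != set0 ->
  exists2 v, v \in internal par r & par v = r.
Proof.
move=> [h hP] /set0Pn [x]; have [k] := ubnP (h x); elim: k x => // k IH x hx xI.
have xr : x != r by move: xI; rewrite inE => /andP[].
have [pr|pr] := eqVneq (par x) r; first by exists x.
apply: (IH (par x)); last exact: par_internal.
exact: leq_trans (hP _ xr) _.
Qed.

Lemma contract_internal_rho par r v : rooted par r -> v \in internal par r ->
  (1 < pdeg par r (par v))%N ->
  [/\ rooted (contract par v) r, internal (contract par v) r = internal par r :\ v &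
    sombor_radius p (parent_rel par r) <
    sombor_radius p (parent_rel (contract par v) r)].
Proof.
move=> rt; rewrite inE => /andP[vr cv] dv; split.
- exact: contract_rooted.
- exact: internal_contract.
exact: contract_rho.
Qed.

Lemma contract_to_double_star par r v w : rooted par r ->
  internal par r = [set v; w] -> v != w -> (1 < pdeg par r (par v))%N ->
  double_star (contract par v) r w /\
  sombor_radius p (parent_rel par r) < S (pdeg (contract par v) r w).
Proof.
move=> rt I2 vw dv; have vI : v \in internal par r by rewrite I2 set21.
have [rt' I' lt] := contract_internal_rho rt vI dv.
have ds : double_star (contract par v) r w.
  apply: internal1_double_star => //; rewrite I' I2.
  apply/setP => z; rewrite !inE; have [->|//] := eqVneq z v.
  by rewrite (negbTE vw).
by split; rewrite // -(double_star_rho ds).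
Qed.

(** Contracting [v] raises the degree of the root and leaves that of [w] alone, so both final
    centres have degree at least 3. *)
Lemma contract_child_rho_lt par r v w : rooted par r ->
  internal par r = [set v; w] -> v != w -> par v = r ->
  (3 <= pdeg par r r)%N -> (3 <= pdeg par r w)%N ->
  sombor_radius p (parent_rel par r) < S 3.
Proof.
move=> rt I2 vw pv dr dw.
have wI : w \in internal par r by rewrite I2 set22.
have vI : v \in internal par r by rewrite I2 set21.
have vr : v != r by move: vI; rewrite inE => /andP[].
have wr : w != r by move: wI; rewrite inE => /andP[].
have [|ds lt] := contract_to_double_star rt I2 vw; first by rewrite pv; lia.
apply: lt_le_trans lt (dstar_rho_le3 _ _).
  by rewrite pdeg_contract// ?pv// eq_sym.
have := double_star_pdegD ds; have := pdeg_contract_u rt vr; rewrite pv.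
by have := internal_pdeg vI; lia.
Qed.

(** The order of the entries decides which of the two vertices gives up its leaf; it costs no
    generality because [v] and [w] play the same part. *)
Lemma exceptional_rho_lt par r v w f : rooted par r -> perron p par r f ->
  internal par r = [set v; w] -> v != w -> par v = r -> par w = r ->
  pdeg par r v = 2%N -> pdeg par r w = 2%N -> f v <= f w ->
  sombor_radius p (parent_rel par r) < S 3.
Proof.
move=> rt pf I2 vw pv pw dv dw fvw.
have wI : w \in internal par r by rewrite I2 set22.
have vI : v \in internal par r by rewrite I2 set21.
have wr : w != r by move: wI; rewrite inE => /andP[].
move: vI; rewrite inE => /andP[vr /set0Pn [l lv]].
have [lr pl] : l != r /\ par l = v by move: lv; rewrite inE => /andP[? /eqP].
have wl : w != l by apply: contraNneq vr => E; rewrite -pl -E pw.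
have wpl : w != par l by rewrite pl eq_sym.
have ds : double_star (move par l w) r w.
  split => //; first by rewrite /move (negbTE wl).
  move=> z zr; rewrite /move; have [zl|zl] := eqVneq z l; first by right.
  have [|pr] := eqVneq (par z) r; first by left.
  right; have : par z \in internal par r by exact: par_internal.
  rewrite I2 !inE => /orP[/eqP pz|/eqP//].
  have : #|children par r v| = 1%N by move: dv; rewrite /pdeg vr addn1 => -[].
  move/eqP/cards1P => [c Ec].
  have := mem_children par zr; rewrite pz Ec inE => /eqP zc.
  by move: lv zl; rewrite Ec inE zc => /eqP ->; rewrite eqxx.
have <- : pdeg (move par l w) r w = 3%N by rewrite pdeg_move_w// dw.
rewrite -(double_star_rho ds).
by apply: move_rho pf _ _ _ _ _ _ _ _ _ _ => //; rewrite ?pl//; exact: double_star_rooted ds.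
Qed.

(* With exactly two internal vertices besides the root, contracting one of them
   leaves a double star; only the tree whose root has two neighbours of degree 2
   may contract to S_{2,n-2}, and it is compared directly with S_{3,n-3}. *)
Lemma two_internal_rho_lt par r : rooted par r -> #|internal par r| = 2%N ->
  (3 <= pdeg par r r)%N -> sombor_radius p (parent_rel par r) < S 3.
Proof.
move=> rt I2 dr.
have [|v vI pv] := internal_child rt; first by rewrite -card_gt0 I2.
have [w I1] : exists w, internal par r :\ v = [set w].
  by apply/cards1P; move: I2; rewrite (cardsD1 v) vI add1n => -[->].
have {I1} IE : internal par r = [set v; w] by rewrite -(setD1K vI) I1.
have vw : v != w.
  by apply/eqP => E; move: I2; rewrite IE E setUid cards1.
have wI : w \in internal par r by rewrite IE set22.
have vr : v != r by move: vI; rewrite inE => /andP[].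
have wr : w != r by move: wI; rewrite inE => /andP[].
have dw2 := internal_pdeg wI; have dv2 := internal_pdeg vI.
have IE' : internal par r = [set w; v] by rewrite setUC.
have wv : w != v by rewrite eq_sym.
have [dw|dw] := leqP 3 (pdeg par r w); first exact: contract_child_rho_lt rt IE vw pv dr dw.
have [pw|pw] := eqVneq (par w) r.
  have [dv|dv] := leqP 3 (pdeg par r v).
    exact: contract_child_rho_lt rt IE' wv pw dr dv.
  have dvE : pdeg par r v = 2%N by lia.
  have dwE : pdeg par r w = 2%N by lia.
  have [f pf] := perron_exists p1 rt.
  have [le|/ltW le] := leP (f v) (f w).
    exact: exceptional_rho_lt rt pf IE vw pv pw dvE dwE le.
  exact: exceptional_rho_lt rt pf IE' wv pw pv dwE dvE le.
have {pw} pw : par w = v.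
  have := par_internal wr pw; rewrite IE !inE => /orP[/eqP//|/eqP E].
  by have := rooted_irr rt wr; rewrite E eqxx.
(* Here [w] hangs from [v]. Contracting [w] into [v] raises [v] to degree at least 3 and leaves the
   degree of the root as it was. *)
have [|ds lt] := contract_to_double_star rt IE' wv; first by rewrite pw.
have := pdeg_contract_u rt wr; rewrite pw => dv'.
apply: lt_le_trans lt (dstar_rho_le3 _ _); first by lia.
have := double_star_pdegD ds; rewrite pdeg_contract//; first by lia.
  by rewrite eq_sym.
by rewrite pw eq_sym.
Qed.

(** Contracting an internal child of the root raises the degree of the root, so degree 2 there is
    harmless as long as three internal vertices remain. *)
Lemma internal_rho_lt par r : rooted par r -> (2 <= #|internal par r|)%N ->
  (2 <= pdeg par r r)%N -> (3 <= #|internal par r|)%N \/ (3 <= pdeg par r r)%N ->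
  sombor_radius p (parent_rel par r) < S 3.
Proof.
have [k] := ubnP #|internal par r|; elim: k par => // k IH par Ik rt I2 d2 d3.
have [I3|I3] := leqP 3 #|internal par r|; last first.
  by case: d3 => [|d3]; [lia|apply: two_internal_rho_lt => //; lia].
have [|v vI pv] := internal_child rt; first by rewrite -card_gt0; lia.
have vr : v != r by move: vI; rewrite inE => /andP[].
have [|rt' I' lt] := contract_internal_rho rt vI; first by rewrite pv.
have cI : (#|internal (contract par v) r|.+1 = #|internal par r|)%N.
  by rewrite I' (cardsD1 v (internal par r)) vI.
have := pdeg_contract_u rt vr; have := internal_pdeg vI; rewrite pv => dv dr'.
by apply: lt_trans lt (IH _ _ rt' _ _ _); lia.
Qed.

Lemma tree_rho_lt (e : rel 'I_n) : (6 <= n)%N -> is_tree e ->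
  ~ graph_iso e (star_rel n) -> ~ graph_iso e (dstar_rel n 2) ->
  ~ graph_iso e (dstar_rel n 3) -> sombor_radius p e < S 3.
Proof.
move=> n6 te Nstar N2 N3.
pose i0 : 'I_n := Ordinal (leq_trans (isT : 0 < 6)%N n6).
(* The maximum degree at the root makes the other centre the smaller one when the tree is already a
   double star. *)
have [r rmax] : exists r, forall x, (deg e x <= deg e r)%N.
  by case: (arg_maxnP (fun x => deg e x) (isT : xpredT i0)) => r _ H; exists r => x; exact: H.
have [par rt eE] := tree_parent_rel r te.
have degE x : deg e x = pdeg par r x.
  by rewrite -deg_parent_rel//; apply: eq_card => y; rewrite !inE eE.
have {}rmax x : (pdeg par r x <= pdeg par r r)%N by rewrite -!degE.
have isoE e' : graph_iso (parent_rel par r) e' -> graph_iso e e'.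
  exact: graph_iso_trans (eq_graph_iso eE).
rewrite (eq_sombor_radius p eE).
have [I0|/set0Pn [x xI]] := eqVneq (internal par r) set0.
  case: Nstar; apply/isoE/parent_star_iso => z zr; apply/eqP; apply: contraT => pr.
  by have := par_internal zr pr; rewrite I0 inE.
have [I2|I1] := leqP 2 #|internal par r|.
  apply: internal_rho_lt => //; first by exact: leq_trans (internal_pdeg xI) (rmax x).
  (* If the root has degree 2, every other vertex has at most one child. Then n - 1 is at most 2
     plus the number of internal vertices, which is therefore at least 3 for n >= 6. *)
  have [d3|d2] := leqP 3 (pdeg par r r); [by right|left].
  have := sum_children par r; rewrite (bigD1 r) //=.
  have : (\sum_(x | x != r) #|children par r x| <= #|internal par r|)%N.
    rewrite -sum1_card [leqRHS]big_mkcond [leqRHS](bigD1 r)//= [r \in _]inE eqxx /= add0n.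
    apply: leq_sum => z zr; case: ifP => [_|/negbT zI]; last by rewrite children_leaf// cards0.
    by have := leq_ltn_trans (rmax z) d2; rewrite {1}/pdeg zr addn1 !ltnS.
  have := n6; move: d2; rewrite /pdeg eqxx addn0.
  by move: (\sum_(x | x != r) _)%N #|internal par r| #|children par r r| => a b c; lia.
have [v Iv] : exists v, internal par r = [set v].
  apply/cards1P; rewrite eqn_leq -ltnS I1 card_gt0; apply/set0Pn; by exists x.
have ds := internal1_double_star rt Iv.
have dv : (1 < pdeg par r v)%N by apply: internal_pdeg; rewrite Iv set11.
have iso := isoE _ (double_star_dstar_iso ds).
have [E|d2] := eqVneq (pdeg par r v) 2%N; first by case: N2; rewrite -E.
have [E|d3] := eqVneq (pdeg par r v) 3%N; first by case: N3; rewrite -E.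
by apply: double_star_rho_lt ds _; rewrite rmax andbT; lia.
Qed.

End SpectralOrder.

Theorem theorem3p2 (R : realType) (p : R) (n : nat) :
  1 <= p -> (6 <= n)%N ->
  (rho (sombor_mx p (dstar_rel n 3)) < rho (sombor_mx p (dstar_rel n 2)) /\
   rho (sombor_mx p (dstar_rel n 2)) < rho (sombor_mx p (star_rel n))) /\
  (forall e : rel 'I_n, is_tree e ->
     ~ graph_iso e (star_rel n) -> ~ graph_iso e (dstar_rel n 2) ->
     ~ graph_iso e (dstar_rel n 3) ->
     rho (sombor_mx p e) < rho (sombor_mx p (dstar_rel n 3))).
Proof.
move=> p1 n6; split; first split.
- by have := @dstar_rho_step R p n p1 3 isT; rewrite -!sombor_radiusE /=; apply; lia.
- have := @dstar_rho_step R p n p1 2 isT; rewrite /= -star_rho; last by lia.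
  by rewrite -!sombor_radiusE; apply; lia.
move=> e te N1 N2 N3.
by have := tree_rho_lt p1 n6 te N1 N2 N3; rewrite -!sombor_radiusE.
Qed.
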